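(* Let $\Gamma$ be a finite graph. Then each of the following conditions is equivalent to $\Gamma$ being cyclically orientable: (1) the edges of $\Gamma$ can be linearly ordered so that different chordless cycles in $\Gamma$ have different maximal edges; (2) $|\operatorname{Cyc}|=|\operatorname{Edg}|-|\operatorname{Ver}|+|\operatorname{Con}|$; (3) the sequence $0\to\mathbb{F}_2^{\operatorname{Con}}\to\mathbb{F}_2^{\operatorname{Ver}}\to\mathbb{F}_2^{\operatorname{Edg}}\to\mathbb{F}_2^{\operatorname{Cyc}}\to0$ is exact.
   Context: Graphs are finite, simple, undirected. A chordless cycle in $\Gamma$ is an induced subgraph isomorphic to a cycle of length at least $3$. $\Gamma$ is cyclically orientable if it admits an orientation of its edges in which every chordless cycle is cyclically oriented (i.e. its edges form a directed cycle). $\operatorname{Ver},\operatorname{Edg},\operatorname{Con},\operatorname{Cyc}$ denote the sets of vertices, edges, connected components, and chordless cycles of $\Gamma$. For a finite set $X$, $\mathbb{F}_2^X$ is the space of functions $X\to\mathbb{F}_2$. For an incidence relation $I\subset X\times Y$ the map $\rho_I:\mathbb{F}_2^X\to\mathbb{F}_2^Y$ is $(\rho_If)(y)=\sum_{(x,y)\in I}f(x)$. The maps in the sequence are $\rho_I$ for the natural incidences: a component contains a vertex, a vertex is an endpoint of an edge, an edge lies in a chordless cycle. *)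

(* Defs.v *)
From HB Require Import structures.
From mathcomp Require Import all_boot all_order all_algebra.

Set Implicit Arguments.
Unset Strict Implicit.
Unset Printing Implicit Defensive.

Import GRing.Theory.
Local Open Scope ring_scope.

Record sgraph := SGraph {
  Ver :> finType;
  adj : rel Ver;
  adj_sym : symmetric adj;
  adj_irr : irreflexive adj }.

Definition induced_iso (U T : finType) (g : rel U) (r : rel T) (S : {set T}) :
    bool :=
  [exists f : {ffun U -> T},
    [&& injectiveb f, f @: [set: U] == S
      & [forall u, forall v, r (f u) (f v) == g u v]]].

Definition dicycle (n : nat) : rel 'I_n := fun i j => j == ordS i.

Definition cycle_graph (n : nat) : rel 'I_n :=
  fun i j => dicycle i j || dicycle j i.

Section Graph.
Variable G : sgraph.

Definition edges : {set {set G}} :=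
  [set [set x; y] | x in [set: G], y in [set: G] & adj x y].

Definition components : {set {set G}} :=
  equivalence_partition (connect (@adj G)) [set: G].

(* An induced subgraph is represented by its vertex set. *)
Definition chordless_cycles : {set {set G}} :=
  [set S : {set G} |
    (3 <= #|S|)%N && induced_iso (@cycle_graph #|S|) (@adj G) S].

Definition Edg : finType := {A : {set G} | A \in edges}.
Definition Con : finType := {A : {set G} | A \in components}.
Definition Cyc : finType := {A : {set G} | A \in chordless_cycles}.

(* o x y means that the edge {x, y} is directed from x to y. *)
Definition orientation (o : rel G) : Prop :=
  (forall x y, adj x y = o x y || o y x) /\ (forall x y, o x y -> ~~ o y x).

Definition cyclically_oriented (o : rel G) (C : Cyc) : Prop :=
  induced_iso (@dicycle #|val C|) o (val C).

Definition cyclically_orientable : Prop :=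
  exists o : rel G, orientation o /\ forall C : Cyc, cyclically_oriented o C.

Definition inc_con_ver (K : Con) (x : Ver G) : bool := x \in val K.
Definition inc_ver_edg (x : Ver G) (a : Edg) : bool := x \in val a.
(* As C is an induced subgraph, its edges are the edges of G with both ends
   in C. *)
Definition inc_edg_cyc (a : Edg) (C : Cyc) : bool := val a \subset val C.

Definition maximal_edge (le : rel Edg) (C : Cyc) (a : Edg) : Prop :=
  inc_edg_cyc a C /\ forall b : Edg, inc_edg_cyc b C -> le b a.

End Graph.

Definition linear_order (X : Type) (le : rel X) : Prop :=
  [/\ reflexive le, antisymmetric le, transitive le & total le].

Definition rho (X Y : finType) (I : X -> Y -> bool) (f : {ffun X -> 'F_2}) :
    {ffun Y -> 'F_2} :=
  [ffun y => \sum_(x | I x y) f x].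

Definition exact_at (A B C : zmodType) (f : A -> B) (g : B -> C) : Prop :=
  forall b : B, g b = 0 <-> exists a : A, f a = b.

(* Exactness of 0 -> A -> B -> C -> D -> 0. *)
Definition exact_sequence (A B C D : zmodType)
    (f : A -> B) (g : B -> C) (h : C -> D) : Prop :=
  [/\ forall a : A, f a = 0 -> a = 0,
      exact_at f g,
      exact_at g h
    & forall d : D, exists c : C, h c = d].

(* Main.v *)
Require Import Defs.
From HB Require Import structures.
From mathcomp Require Import all_boot all_order all_algebra zify.

Set Implicit Arguments.
Unset Strict Implicit.
Unset Printing Implicit Defensive.

Import GRing.Theory.

(** Every graph with an edge has a non-isolated vertex x such that any two
    neighbours of x lie together with x on a chordless cycle: choose x and a
    component D of the complement of its closed neighbourhood with #|D| maximal;
    then every vertex outside D and N(D) is adjacent to all of N(D), and one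
    recurses into that set.  All the implications are proved by induction,
    removing such an x.

    If the graph is cyclically oriented, two edges at x on a common chordless
    cycle have opposite directions at x, so x has at most two neighbours;
    moreover x lies on at most one chordless cycle, since two of them would part
    at a vertex v, and the two edges leaving v would again lie on a common
    chordless cycle.  Putting the edges at x on top of an order of the remaining
    ones gives (1), and (1) makes the last map of (3) surjective by
    triangularity.

    The same vertex x shows that the sequence is always exact except at its last
    term, so that surjectivity of the last map is equivalent to (3) and, by
    counting, to (2).  If the last map is surjective, linear algebra again shows
    that x has at most two neighbours and lies on at most one chordless cycle.
    When these neighbours y and z are not adjacent, replacing the path y x z by
    an edge y z preserves surjectivity, and a cyclic orientation of the smaller
    graph lifts back. *)

(** * Induced paths and chordless cycles *)

(** Graphs are handled as relations on a fixed vertex type, so that inductions can change the edges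
    without changing the type. For [adj], this set and the next one are [edges] and
    [chordless_cycles] up to conversion. *)
Definition edge_sets (T : finType) (r : rel T) : {set {set T}} :=
  [set [set x; y] | x in [set: T], y in [set: T] & r x y].

Definition chordless (T : finType) (r : rel T) : {set {set T}} :=
  [set S : {set T} | (3 <= #|S|) && induced_iso (@cycle_graph #|S|) r S].

Lemma induced_iso_agree (U T : finType) (g : rel U) (r r' : rel T)
    (S : {set T}) :
  {in S &, r =2 r'} -> induced_iso g r S = induced_iso g r' S.
Proof.
move=> rr'; apply: eq_existsb => f.
case: (injectiveb f) => //=; case: eqP => //= fS.
apply: eq_forallb => u; apply: eq_forallb => v.
by rewrite rr' // -fS imset_f.
Qed.

Lemma chordless_agree (T : finType) (r r' : rel T) (S : {set T}) :
  {in S &, r =2 r'} -> (S \in chordless r) = (S \in chordless r').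
Proof. by move=> rr'; rewrite !inE (induced_iso_agree _ rr'). Qed.

(** Vertices outside [A] stay in the type, but become isolated. *)
Definition restrict (T : finType) (r : rel T) (A : {set T}) : rel T :=
  [rel u v | [&& r u v, u \in A & v \in A]].

Section InducedPaths.
Variables (T : finType) (r : rel T).
Hypotheses (rsym : symmetric r) (rirr : irreflexive r).

(** Induced paths. The default of [head] is reached only for empty [q], where the [all] is
    vacuous. *)
Fixpoint ipath (s : seq T) : bool :=
  if s is a :: q then
    [&& a \notin q, all (fun u => r a u == (u == head a q)) q & ipath q]
  else true.

(** The description by positions is symmetric in both ends, which gives closure under reversal. *)
Lemma ipathP x0 s :
  reflect (uniq s /\ forall i j, i < size s -> j < size s ->
             r (nth x0 s i) (nth x0 s j) = (j == i.+1) || (i == j.+1))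
          (ipath s).
Proof.
elim: s => [|a q IH] /=; first by apply: (iffP idP) => // _; split.
apply: (iffP and3P) => [[aq /allP ra /IH[uq rq]]|[/andP[aq uq] rq]].
  split=> [|i j]; first by rewrite aq.
  have nth_head k : k < size q -> (nth x0 q k == head a q) = (k == 0).
    move=> kq; case: q kq {IH ra aq rq} uq => //= b q kq uq.
    by rewrite -[b in _ == b]/(nth x0 (b :: q) 0) nth_uniq.
  case: i j => [|i] [|j] //=.
  - move=> _ jq; rewrite (eqP (ra _ (mem_nth x0 jq))) nth_head //; lia.
  - move=> iq _; rewrite rsym (eqP (ra _ (mem_nth x0 iq))) nth_head //; lia.
  - by move=> iq jq; rewrite rq.
split=> //; last first.
  by apply/IH; split=> // i j iq jq; rewrite (rq i.+1 j.+1).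
apply/allP=> u uinq; rewrite -(nth_index x0 uinq).
have iuq : index u q < size q by rewrite index_mem.
rewrite (rq 0 (index u q).+1) //.
case: q uinq iuq {IH rq aq} uq => //= b q _ iuq uq.
by rewrite -[X in _ == (_ == X)]/(nth x0 (b :: q) 0) nth_uniq //=; apply/eqP; lia.
Qed.

Lemma ipath_uniq s : ipath s -> uniq s.
Proof. by case: s => // a q /(ipathP a)[]. Qed.

Lemma ipath_rev s : ipath s -> ipath (rev s).
Proof.
case: s => // x0 q; set s := x0 :: q => /(ipathP x0)[us rs].
apply/(ipathP x0); rewrite rev_uniq size_rev; split=> // i j ilt jlt.
rewrite !nth_rev // rs; lia.
Qed.

Lemma ipath_catr s1 s2 : ipath (s1 ++ s2) -> ipath s2.
Proof. by elim: s1 => //= a s1 IH /and3P[_ _ /IH]. Qed.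

Lemma ipath_catl s1 s2 : ipath (s1 ++ s2) -> ipath s1.
Proof.
move=> /ipath_rev; rewrite rev_cat => /ipath_catr/ipath_rev.
by rewrite revK.
Qed.

Lemma restrict_connect_sym (A : {set T}) : connect_sym (restrict r A).
Proof. by apply: sym_connect_sym => u v; rewrite /restrict /= rsym
  [X in _ && X]andbC. Qed.

Lemma restrict_sub (A B : {set T}) : A \subset B ->
  subrel (connect (restrict r A)) (connect (restrict r B)).
Proof.
move=> /subsetP AB; apply: connect_sub => u v /and3P[ruv uA vA].
by apply: connect1; rewrite /restrict /= ruv !AB.
Qed.

Lemma ipath_connect (A : {set T}) a p : ipath (a :: p) ->
  {subset a :: p <= A} -> connect (restrict r A) a (last a p).
Proof.
elim: p a => [|b p IH] a /=; first by move=> *; apply: connect0.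
move=> /and3P[_ /andP[/eqP rab _] ip] sA.
apply: (@connect_trans _ _ b); last first.
  by apply: IH => // u ub; apply: sA; rewrite inE ub orbT.
by apply: connect1; rewrite /restrict /= rab eqxx !sA // !inE eqxx ?orbT.
Qed.

(** Cut the path at its last vertex equal or adjacent to [y]: no later vertex is adjacent to [y], so
    putting [y] in front creates no chord. *)
Lemma ipath_extend y s : ipath s -> s != [::] ->
  (y \in s) || has (r y) s ->
  exists p, [/\ ipath (y :: p), last y p = last y s
               & {subset y :: p <= y :: s}].
Proof.
elim: s => // a q IH /= /and3P[aq ra iq] _.
have [yq|] := boolP ((y \in q) || has (r y) q).
  have q0 : q != [::] by case: (q) yq.
  have [p [ip lp sp]] := IH iq q0 yq => _.
  exists p; split=> //; first by rewrite lp; case: (q) q0.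
  by move=> u /sp; rewrite !inE => /orP[->|->]; rewrite ?orbT.
rewrite negb_or => /andP[yq nyq].
rewrite inE (negPf yq) orbF (negPf nyq) orbF => /orP[/eqP->|rya].
  exists q; split=> //=; first by rewrite aq ra.
  by move=> u; rewrite !inE => /orP[->|->]; rewrite ?orbT.
exists (a :: q); split=> //=.
rewrite inE negb_or yq aq ra iq rya eqxx !andbT /=.
have -> : y != a by apply: contraTneq rya => ->; rewrite rirr.
apply/allP=> u uq /=; rewrite (negPf (hasPn nyq u uq)).
by rewrite eq_sym eqbF_neg; apply: contraNneq aq => <-.
Qed.

Lemma connect_ipath (A : {set T}) y z : y \in A ->
  connect (restrict r A) y z ->
  exists p, [/\ ipath (y :: p), last y p = z & {subset y :: p <= A}].
Proof.
move=> + /connectP[p pp ->]; elim: p y pp => [|b p IH] y /=.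
  by move=> _ yA; exists [::]; split=> // u; rewrite inE => /eqP->.
move=> /andP[/and3P[ryb _ bA] pp] yA.
have [q [iq lq sq]] := IH b pp bA.
have [|q' [iq' lq' sq']] := @ipath_extend y _ iq isT.
  by rewrite /= ryb !orbT.
exists q'; split=> //; first by rewrite lq' /= lq.
by move=> u /sq'; rewrite inE => /orP[/eqP->//|/sq].
Qed.

(** A chordless cycle cut open at [x]: the remaining vertices form an induced path, and [x] is
    adjacent exactly to its two ends. *)
Definition cyc_at (x : T) (p : seq T) : bool :=
  [&& x \notin p, 2 <= size p, ipath p &
      all (fun u => r x u == (u == head x p) || (u == last x p)) p].

Lemma cyc_at_rev x p : cyc_at x p -> cyc_at x (rev p).
Proof.
move=> /and4P[xp sp ip ap]; rewrite /cyc_at mem_rev size_rev xp sp ipath_rev //=.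
rewrite all_rev; apply/allP=> u /(allP ap)/eqP->; rewrite orbC.
case/lastP: p {xp sp ip ap} => // p b.
by rewrite rev_rcons /= last_rcons; case: p => //= a p; rewrite rev_cons last_rcons.
Qed.

Let cyc_rel n i j := [|| j == i.+1, i == j.+1, (i == 0) && (j == n.-1)
                       | (j == 0) && (i == n.-1)].

Let cseq (s : seq T) := [/\ uniq s, 3 <= size s &
  forall x0 i j, i < size s -> j < size s ->
    r (nth x0 s i) (nth x0 s j) = cyc_rel (size s) i j].

Let cycle_graphE n (i j : 'I_n) : 2 < n -> cycle_graph i j = cyc_rel n i j.
Proof.
move=> n2; rewrite /cycle_graph /dicycle -!val_eqE /=.
case: i j => i ilt [j jlt] /=.
have modS k : k < n -> k.+1 %% n = if k.+1 == n then 0 else k.+1.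
  by move=> kn; case: eqP => [->|kn']; rewrite ?modnn // modn_small //; lia.
by rewrite /cyc_rel !modS //; do 2![case: ifPn]; lia.
Qed.

Let cseq_chordless s : cseq s -> [set u in s] \in chordless r.
Proof.
move=> [us ss rs]; rewrite inE.
have cs : #|[set u in s]| = size s by rewrite cardsE; apply/card_uniqP.
rewrite cs ss /=.
case: s us ss rs cs => // x0 q; set s := x0 :: q => us ss rs cs.
apply/existsP; exists [ffun i : 'I_(size s) => nth x0 s i].
apply/and3P; split.
- apply/injectiveP=> i j; rewrite !ffunE => /eqP.
  by rewrite nth_uniq // => /eqP/val_inj.
- apply/eqP/setP=> u; rewrite inE; apply/imsetP/idP => [[i _ ->]|us'].
    by rewrite ffunE mem_nth.
  have iu : index u s < size s by rewrite index_mem.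
  by exists (Ordinal iu); rewrite ?inE // ffunE nth_index.
- apply/forallP=> i; apply/forallP=> j; apply/eqP.
  by rewrite !ffunE rs // cycle_graphE.
Qed.

Let chordless_cseq (C : {set T}) x : C \in chordless r -> x \in C ->
  exists p, cseq (x :: p) /\ C = [set u in x :: p].
Proof.
rewrite inE => /andP[]; set n := #|C| => n3.
move=> /existsP[f /and3P[/injectiveP finj /eqP fC /'forall_'forall_eqP rf]].
rewrite -{1}fC => /imsetP[[i0 i0n] _ xf].
have n0 : 0 < n by lia.
(* [F] rotates the given enumeration so that it starts at [x]. *)
pose F k := f (Ordinal (ltn_pmod (i0 + k) n0)).
have F0 : F 0 = x.
  by rewrite xf /F; congr (f _); apply: val_inj; rewrite /= addn0 modn_small.
have FE k : k < n -> val (Ordinal (ltn_pmod (i0 + k) n0)) =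
    if i0 + k < n then i0 + k else i0 + k - n.
  move=> kn /=; case: ifPn => h; first by rewrite modn_small.
  by rewrite -[in LHS](@subnK n (i0 + k)) ?modnDr ?modn_small //; lia.
have mkE : mkseq F n = x :: behead (mkseq F n).
  have mkS k : 0 < k -> mkseq F k = F 0 :: behead (mkseq F k) by case: k.
  by rewrite -F0; apply: mkS.
have uF : uniq (mkseq F n).
  apply/(uniqP x) => i j; rewrite !inE size_mkseq => ilt jlt.
  rewrite !nth_mkseq // => /finj/(congr1 val); rewrite !FE //.
  by do 2![case: ifPn]; lia.
exists (behead (mkseq F n)); rewrite -mkE; split; last first.
  apply/eqP; rewrite eq_sym eqEcard cardsE (card_uniqP uF) size_mkseq leqnn andbT.
  apply/subsetP=> u; rewrite inE => /(nthP x)[i]; rewrite size_mkseq => ilt <-.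
  by rewrite nth_mkseq // -fC imset_f.
split=> //; rewrite size_mkseq // => x0 i j ilt jlt.
rewrite !nth_mkseq // rf cycle_graphE // !FE // /cyc_rel.
do 2![case: ifPn]; lia.
Qed.

Let cseq_at x p : cseq (x :: p) <-> cyc_at x p.
Proof.
split.
  move=> [/= /andP[xp up] sp rp]; apply/and4P; split=> //.
    apply/(ipathP x); split=> // i j ip jp.
    by rewrite (rp x i.+1 j.+1) // /cyc_rel /=; lia.
  apply/allP=> u /(nthP x)[i ip <-]; rewrite (rp x 0 i.+1) //.
  have p0 : (size p).-1 < size p by case: (p) sp.
  rewrite -nth0 -nth_last !nth_uniq // ?(leq_ltn_trans _ p0) //.
  by rewrite /cyc_rel; apply/eqP; move: ip => /= ip; lia.
move=> /and4P[xp sp /ipathP ip /allP ap].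
have up := (ip x).1; split=> //=; first by rewrite xp.
have rx x0 k : k < size p -> r x (nth x0 p k) = (k == 0) || (k == (size p).-1).
  move=> kp; rewrite (eqP (ap _ (mem_nth x0 kp))) -nth0 -nth_last.
  have p0 : (size p).-1 < size p by case: (p) sp.
  have p1 := leq_ltn_trans (leq0n _) p0.
  by rewrite (set_nth_default x0 x p1) (set_nth_default x0 x p0) !nth_uniq.
move=> x0 [|i] [|j] //= ilt jlt; rewrite /cyc_rel ?rirr.
- lia.
- by rewrite rx //; lia.
- by rewrite rsym rx //; lia.
- by rewrite (ip x0).2 //; lia.
Qed.

Lemma cyc_at_chordless x p : cyc_at x p -> [set u in x :: p] \in chordless r.
Proof. by move=> /cseq_at/cseq_chordless. Qed.

Lemma chordless_cyc_at (C : {set T}) x : C \in chordless r -> x \in C ->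
  exists2 p, cyc_at x p & C = [set u in x :: p].
Proof. by move=> CC xC; have [p [/cseq_at cp ->]] := chordless_cseq CC xC; exists p. Qed.

Lemma cyc_at_head_last x p : cyc_at x p ->
  [/\ head x p \in p, last x p \in p & head x p != last x p].
Proof.
case: p => [|a [|b p]] //; first by rewrite /cyc_at /= andbF.
move=> /and4P[_ _ /ipath_uniq/= /andP[ap _] _].
split; [exact: mem_head | exact: (mem_last a (b :: p)) |] => /=.
by apply: contraNneq ap => ->; rewrite mem_last.
Qed.

Lemma cyc_at_adj x p u : cyc_at x p -> u \in x :: p ->
  r x u = (u == head x p) || (u == last x p).
Proof.
move=> cp; have [hp lp _] := cyc_at_head_last cp.
move: (cp) => /and4P[xp _ _ /allP ap].
rewrite inE => /orP[/eqP->|/ap/eqP//].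
rewrite rirr; apply/esym/negbTE; rewrite negb_or.
by apply/andP; split; apply: contraNneq xp => {1}->.
Qed.

Lemma chordless_nbrs (C : {set T}) x : C \in chordless r -> x \in C ->
  exists y z, [/\ y != z, y \in C, z \in C &
    {in C, forall u, r x u = (u == y) || (u == z)}].
Proof.
move=> CC xC; have [p cp ->] := chordless_cyc_at CC xC.
have [hp lp hl] := cyc_at_head_last cp.
exists (head x p), (last x p); rewrite !inE hp lp !orbT; split=> // u.
by rewrite inE => /(cyc_at_adj cp).
Qed.

Lemma chordless_nbr2 (C : {set T}) x y z : C \in chordless r ->
  x \in C -> y \in C -> z \in C -> r x y -> r x z -> y != z ->
  {in C, forall u, r x u = (u == y) || (u == z)}.
Proof.
move=> CC xC yC zC rxy rxz yz u uC.
have [a [b [ab aC bC rx]]] := chordless_nbrs CC xC.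
move: rxy rxz; rewrite !rx // => /orP[]/eqP ya /orP[]/eqP zb; subst => //.
- by rewrite eqxx in yz.
- by rewrite orbC.
- by rewrite eqxx in yz.
Qed.

(** An induced path from [y] to [z] inside [A] closes up through [x]; no chord arises, since [A]
    contains no other neighbour of [x]. *)
Lemma connect_chordless (A : {set T}) x y z :
  r x y -> r x z -> y != z -> y \in A -> connect (restrict r A) y z ->
  {in A, forall u, u != x /\ (r x u -> u = y \/ u = z)} ->
  exists2 C, C \in chordless r &
    [/\ x \in C, y \in C, z \in C & C \subset x |: A].
Proof.
move=> rxy rxz yz yA /(connect_ipath yA)[p [ip lp sp]] Ax.
have zp : z \in y :: p by rewrite -lp mem_last.
exists [set u in x :: y :: p].
  apply: cyc_at_chordless; rewrite /cyc_at ip andTb; apply/and3P; split.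
  - by apply/negP=> /sp/Ax[]; rewrite eqxx.
  - by case: p lp {ip sp zp} yz => //= ->; rewrite eqxx.
  - apply/allP=> u /sp/Ax[_ h] /=; rewrite lp; apply/eqP.
    by apply/idP/orP => [/h[]->|[]/eqP->//]; [left|right].
rewrite !inE !eqxx ?orbT; split=> //; first by move: zp; rewrite inE => ->; rewrite orbT.
apply/subsetP=> u; rewrite inE in_setU1 inE => /orP[->//|/sp->].
by rewrite orbT.
Qed.

End InducedPaths.

(** * Vertices whose neighbours are pairwise joined by chordless cycles *)

Lemma edge_setsP (T : finType) (r : rel T) (e : {set T}) :
  reflect (exists u v, r u v /\ e = [set u; v]) (e \in edge_sets r).
Proof.
apply: (iffP imset2P) => [[u v _]|[u [v [ruv ->]]]].
  by rewrite !inE => ruv ->; exists u, v.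
by exists u v; rewrite ?inE.
Qed.

Lemma edge_sets_agree (T : finType) (r r' : rel T) (S e : {set T}) :
  {in S &, r =2 r'} -> e \subset S -> (e \in edge_sets r) = (e \in edge_sets r').
Proof.
move=> rr' /subsetP eS; apply/edge_setsP/edge_setsP => -[u [v [ruv eE]]];
  exists u, v; split=> //; move: ruv; rewrite rr' // eS // eE !inE eqxx ?orbT //.
Qed.

Lemma subset_setC1 (T : finType) (C : {set T}) x :
  (C \subset [set~ x]) = (x \notin C).
Proof. by rewrite subsetC sub1set in_setC. Qed.

Definition nonisolated (T : finType) (r : rel T) : {set T} :=
  [set u | [exists v, r u v]].

Lemma nonisolatedP (T : finType) (r : rel T) u :
  reflect (exists v, r u v) (u \in nonisolated r).
Proof. by rewrite inE; apply: existsP. Qed.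

Lemma nonisolated0 (T : finType) (r : rel T) u v :
  nonisolated r = set0 -> r u v = false.
Proof.
move=> r0; apply/negP=> ruv.
have /nonisolatedP : exists v, r u v by exists v.
by rewrite r0 inE.
Qed.

(** This weakens the notion of a simplicial vertex: adjacent neighbours of [x] form a triangle with
    it, which is a chordless cycle. *)
Definition cycle_simplicial (T : finType) (r : rel T) (x : T) : Prop :=
  forall y z, r x y -> r x z -> y != z ->
    exists2 C, C \in chordless r & [/\ x \in C, y \in C & z \in C].

(** A path starting at [v] never leaves what is reachable from [v]. *)
Lemma connect_closed (T : finType) (e : rel T) (v u : T) : connect e v u ->
  connect [rel a b | [&& e a b, connect e v a & connect e v b]] v u.
Proof.
move=> /connectP[p + ->]; elim/last_ind: p => [|p b IH] /=.
  by move=> _; apply: connect0.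
rewrite rcons_path last_rcons => /andP[pp epb].
have vp : connect e v (last v p) by apply/connectP; exists p.
apply: connect_trans (IH pp) _; apply: connect1 => /=.
by rewrite epb vp (connect_trans vp) // connect1.
Qed.

Section Graph.
Variables (T : finType) (r : rel T).
Hypotheses (rsym : symmetric r) (rirr : irreflexive r).

Lemma restrict_symmetric (A : {set T}) : symmetric (restrict r A).
Proof. by move=> u v; rewrite /restrict /= rsym [X in _ && X]andbC. Qed.

Lemma restrict_irreflexive (A : {set T}) : irreflexive (restrict r A).
Proof. by move=> u; rewrite /restrict /= rirr. Qed.

Lemma restrict_in (A C : {set T}) : C \subset A -> {in C &, restrict r A =2 r}.
Proof.
by move=> /subsetP CA u v uC vC; rewrite /restrict /= !CA // !andbT.
Qed.

Lemma chordless_restrict (A C : {set T}) :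
  (C \in chordless (restrict r A)) = (C \in chordless r) && (C \subset A).
Proof.
case: (boolP (C \subset A)) => [CA|nCA].
  by rewrite andbT; apply/chordless_agree/restrict_in.
rewrite andbF; apply/negP => CC; case/negP: nCA.
apply/subsetP=> x xC.
have [y [z [_ yC _ rx]]] :=
  chordless_nbrs (restrict_symmetric A) (restrict_irreflexive A) CC xC.
by move: (rx y yC); rewrite eqxx => /and3P[].
Qed.

Lemma chordless_del x (C : {set T}) :
  (C \in chordless (restrict r [set~ x])) = (C \in chordless r) && (x \notin C).
Proof. by rewrite chordless_restrict subset_setC1. Qed.

Lemma nonisolated_del x : x \in nonisolated r ->
  #|nonisolated (restrict r [set~ x])| < #|nonisolated r|.
Proof.
move=> xr; apply/proper_card/properP; split.
  apply/subsetP=> u /nonisolatedP[v /and3P[ruv _ _]].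
  by apply/nonisolatedP; exists v.
exists x => //; apply/nonisolatedP => -[v].
by rewrite /restrict /= !inE eqxx andbF.
Qed.

(** A connection that avoids [x] and its other neighbours is what [connect_chordless] asks for.
    Working inside an arbitrary [W] is what allows the recursion into [R]. *)
Lemma separating_vertex (W : {set T}) : W != set0 ->
  exists2 x, x \in W & forall y z, y \in W -> z \in W ->
    r x y -> r x z -> y != z ->
    connect (restrict r
      [set u in W | (u != x) && (r x u ==> (u == y) || (u == z))]) y z.
Proof.
have [n] := ubnP #|W|; elim: n W => // n IH W /ltnSE-Wn /set0Pn[w wW].
pose Q (p : T * T) := [&& p.1 \in W, p.2 \in W, p.2 != p.1 & ~~ r p.1 p.2].
pose B x := [set u in W | (u != x) && ~~ r x u].
pose comp (p : T * T) := [set u | connect (restrict r (B p.1)) p.2 u].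
(* Without a non-adjacent pair, [W] is a clique and any of its vertices works. *)
case: (pickP Q) => [p0 Qp0|noQ]; last first.
  exists w => // y z yW zW rwy rwz yz; apply: connect1.
  have := noQ (y, z); rewrite /Q /restrict /= !inE yW zW eq_sym yz !eqxx rwy rwz !orbT.
  have ->: y != w by apply: contraTneq rwy => ->; rewrite rirr.
  have ->: z != w by apply: contraTneq rwz => ->; rewrite rirr.
  by move=> /= /negbFE ->.
case: (arg_maxnP (fun p => #|comp p|) Qp0) => -[x v].
rewrite /Q /= => /and4P[xW vW vx rxv] maxD.
set D := comp (x, v) in maxD.
have vD : v \in D by rewrite inE connect0.
have DB : D \subset B x.
  apply/subsetP=> u; rewrite inE /= => /connect_closed/connectP[p].
  case/lastP: p => [_ ->|p b]; first by rewrite inE vW vx rxv.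
  by rewrite rcons_path last_rcons => /andP[_ /and3P[/and3P[_ _ ?] _ _]] ->.
have conD (A : {set T}) d : D \subset A -> d \in D -> connect (restrict r A) v d.
  move=> /subsetP DA; rewrite inE => /connect_closed /=.
  apply: connect_sub => a b /= /and3P[/and3P[rab _ _] va vb].
  by apply: connect1; rewrite /restrict /= rab !DA // inE.
clearbody D.
pose N := [set u in W | (u \notin D) && [exists d in D, r u d]].
pose R := [set u in W | (u \notin D) && (u \notin N)].
have NP u : u \in N -> [/\ u \in W, u \notin D & exists2 d, d \in D & r u d].
  by rewrite inE => /and3P[-> -> /exists_inP].
have RD x' d : x' \in R -> d \in D -> r x' d = false.
  rewrite !inE => /and3P[-> -> /=] /exists_inPn nd dD.
  by apply/negbTE/nd.
have DR x' : x' \in R -> D \subset B x'.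
  move=> x'R; apply/subsetP=> d dD.
  have := subsetP DB d dD; rewrite !inE => /andP[-> _].
  rewrite RD // andbT andTb; apply: contraTneq x'R => <-.
  by rewrite inE dD andbF.
(* If [x'] were not adjacent to [s], the component of [v] away from [x'] would contain [D] and also
   [s], against the maximality of [D]. *)
have RN x' s : x' \in R -> s \in N -> r x' s.
  move=> x'R sN; have [sW sD [d dD rsd]] := NP _ sN.
  have sx' : s != x' by apply: contraTneq sN => ->; move: x'R; rewrite inE => /and3P[].
  apply: contraT => nx's.
  have Dx' := DR _ x'R.
  have vB := subsetP Dx' v vD.
  have: #|comp (x', v)| <= #|D|.
    apply: maxD => /=; rewrite vW.
    by move: x'R vB; rewrite !inE => /andP[-> _] /and3P[_ -> ->].
  rewrite leqNgt => /negP[]; apply/proper_card/properP; split.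
    by apply/subsetP=> u uD; rewrite inE; apply: conD.
  exists s => //; rewrite inE /=; apply: connect_trans (conD _ _ Dx' dD) _.
  apply: connect1; rewrite /restrict /= rsym rsd (subsetP Dx') // inE sW sx'.
  by rewrite nx's.
have xR : x \in R.
  have nD : x \notin D by apply/negP=> /(subsetP DB); rewrite inE eqxx andbF.
  rewrite !inE xW nD /=; apply/exists_inPn => d /(subsetP DB).
  by rewrite inE => /and3P[].
have RW : R \proper W.
  apply/properP; split; first by apply/subsetP=> u; rewrite inE => /andP[].
  by exists v => //; rewrite inE vD andbF.
have [||x' x'R good] := IH R.
- by apply: leq_trans Wn; apply: proper_card.
- by apply/set0Pn; exists x.
have x'W : x' \in W by apply: (subsetP (proper_sub RW)).
exists x' => // y z yW zW rxy rxz yz.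
have split_nbr u : u \in W -> r x' u -> (u \in R) || (u \in N).
  move=> uW rxu; rewrite 2!inE uW /=.
  have -> : u \notin D by apply: contraTN rxu => /RD->.
  by rewrite /= orNb.
have ux' u : r x' u -> u != x' by move=> h; apply: contraTneq h => ->; rewrite rirr.
(* Two neighbours in [R] are joined by recursion, one in [R] and one in [N] are adjacent by [RN],
   and two in [N] are joined through [D], which contains no neighbour of [x']. *)
case/orP: (split_nbr y yW rxy) => [yR|yN]; case/orP: (split_nbr z zW rxz) => [zR|zN].
- apply: restrict_sub (good y z yR zR rxy rxz yz).
  apply/subsetP=> u; rewrite [in X in X -> _]inE => /andP[uR h]; rewrite inE h andbT.
  exact: (subsetP (proper_sub RW)).
- apply: connect1; rewrite /restrict /= RN // !inE yW zW !ux' //= !eqxx ?orbT.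
  by rewrite !implybT.
- apply: connect1; rewrite /restrict /= rsym RN // !inE yW zW !ux' //= !eqxx ?orbT.
  by rewrite !implybT.
- set A := [set u in W | _].
  have yA : y \in A by rewrite inE yW ux' // eqxx implybT.
  have zA : z \in A by rewrite inE zW ux' // eqxx orbT implybT.
  have DA : D \subset A.
    apply/subsetP=> d dD; have := subsetP (DR _ x'R) d dD.
    by rewrite !inE => /and3P[-> -> /negPf->].
  have [_ _ [d dD ryd]] := NP _ yN; have [_ _ [d' dD' rzd]] := NP _ zN.
  have vy : connect (restrict r A) v y.
    apply: connect_trans (conD _ _ DA dD) _; apply: connect1.
    by rewrite /restrict /= rsym ryd yA (subsetP DA).
  have vz : connect (restrict r A) v z.
    apply: connect_trans (conD _ _ DA dD') _; apply: connect1.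
    by rewrite /restrict /= rsym rzd zA (subsetP DA).
  by apply: connect_trans vz; rewrite restrict_connect_sym.
Qed.

Lemma cycle_simplicial_vertex : nonisolated r != set0 ->
  exists2 x, x \in nonisolated r & cycle_simplicial r x.
Proof.
move=> /separating_vertex[x xr good]; exists x => // y z rxy rxz yz.
have nb u : r x u -> u \in nonisolated r /\ u != x.
  move=> rxu; split; first by apply/nonisolatedP; exists x; rewrite rsym.
  by apply: contraTneq rxu => ->; rewrite rirr.
have [yr yx] := nb y rxy; have [zr zx] := nb z rxz.
have [| |C CC [xC yC zC _]] :=
  connect_chordless rsym rirr rxy rxz yz _ (good y z yr zr rxy rxz yz).
- by rewrite inE yr yx eqxx implybT.
- move=> u; rewrite inE => /and3P[_ ux /implyP h]; split=> // /h/orP[]/eqP->; auto.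
by exists C.
Qed.

Lemma chordless_cyc_from (C : {set T}) x y z : C \in chordless r ->
  x \in C -> y \in C -> z \in C -> r x y -> r x z -> y != z ->
  exists p, [/\ cyc_at r x (y :: p), C = [set u in x :: y :: p]
              & last y p = z].
Proof.
move=> CC xC yC zC rxy rxz yz.
have [q cq CE] := chordless_cyc_at rsym rirr CC xC.
(* If [y] comes last instead of first, the cycle is reversed. *)
wlog yq : q cq CE / y = head x q => [wl|].
  have: y \in x :: q by move: yC; rewrite CE inE.
  move=> /(cyc_at_adj rsym rirr cq); rewrite rxy => /esym/orP[/eqP|/eqP yl].
    exact: wl cq CE.
  apply: (wl (rev q)); first exact: cyc_at_rev.
    by rewrite CE; apply/setP=> u; rewrite !inE mem_rev.
  by rewrite yl; case/lastP: (q) => // ? ?; rewrite last_rcons rev_rcons.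
case: q cq CE yq => [|y' q] cq CE /= yq; first by case/and4P: cq.
subst y'; exists q; split=> //.
have: z \in x :: y :: q by move: zC; rewrite CE inE.
by move=> /(cyc_at_adj rsym rirr cq); rewrite rxz eq_sym (negPf yz) /= => /esym/eqP.
Qed.

End Graph.

(** Neither sequence is a proper prefix of the other: the common last element would occur twice in
    the longer one. *)
Lemma diverge (T : eqType) (y : T) (p q : seq T) :
  uniq (y :: p) -> uniq (y :: q) -> last y p = last y q -> p <> q ->
  exists u v a b p' q', [/\ y :: p = u ++ v :: a :: p',
    y :: q = u ++ v :: b :: q' & a != b].
Proof.
elim: p y q => [|a p IH] y [|b q] //=.
- by move=> _ /andP[yq _] yE; case/negP: yq; rewrite yE mem_last.
- by move=> /andP[yp _] _ yE; case/negP: yp; rewrite -yE mem_last.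
move=> /andP[_ up] /andP[_ uq] lpq pq.
have [abE|ab] := eqVneq a b; last by exists [::], y, a, b, p, q.
subst b; have [|u [v [a' [b' [p' [q' [-> -> ab']]]]]]] := IH a q up uq lpq.
  by move=> pq'; apply: pq; rewrite pq'.
by exists (y :: u), v, a', b', p', q'.
Qed.

(** * Orientations that alternate along chordless cycles *)

Definition orients (T : finType) (r o : rel T) : Prop :=
  (forall x y, r x y = o x y || o y x) /\ (forall x y, o x y -> ~~ o y x).

(** The local form of a cyclic orientation: of the two edges of [C] at [x], exactly one leaves [x].
    Unlike an enumeration of each cycle, it passes directly to induced subgraphs. *)
Definition alternating (T : finType) (r o : rel T) : Prop :=
  forall (C : {set T}) x y z, C \in chordless r ->
    x \in C -> y \in C -> z \in C -> r x y -> r x z -> y != z ->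
    o x y = ~~ o x z.

Section Oriented.
Variables (T : finType) (r o : rel T).
Hypotheses (rsym : symmetric r) (rirr : irreflexive r).
Hypothesis (oalt : alternating r o).

(** Where the two cycles part, the edge just traversed and the two edges ahead lie pairwise on
    common chordless cycles, so they would have three pairwise different directions. *)
Lemma alternating_chordless_inj (C D : {set T}) x y z :
  C \in chordless r -> D \in chordless r ->
  [/\ x \in C, y \in C & z \in C] -> [/\ x \in D, y \in D & z \in D] ->
  r x y -> r x z -> y != z -> C = D.
Proof.
move=> CC DC [xC yC zC] [xD yD zD] rxy rxz yz.
have [p [cp CE lp]] := chordless_cyc_from rsym rirr CC xC yC zC rxy rxz yz.
have [q [cq DE lq]] := chordless_cyc_from rsym rirr DC xD yD zD rxy rxz yz.
have [pq|/eqP pq] := eqVneq p q; first by rewrite CE DE pq.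
have [/and4P[xp _ ip _] /and4P[xq _ iq _]] := (cp, cq).
have [u [v [a [b [p' [q' [pE qE ab]]]]]]] :
    exists u v a b p' q', [/\ y :: p = u ++ v :: a :: p',
    y :: q = u ++ v :: b :: q' & a != b].
  by apply: diverge; rewrite ?lp ?lq //; apply: ipath_uniq; eassumption.
rewrite pE in xp ip; rewrite qE in xq iq.
(* The vertex before [v] on both cycles; it is [x] when they part already at [y]. *)
pose w := last x u.
have wE s c s' : y :: s = u ++ v :: c :: s' -> ipath r (u ++ v :: c :: s') ->
    x \notin u ++ v :: c :: s' -> 
    [/\ r v w, w \notin c :: s', ipath r (v :: c :: s') & w \in x :: y :: s].
  move=> sE isp xs; rewrite sE /w.
  case/lastP: (u) isp xs sE => [|u' w'] /= isp xs sE.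
    case: sE => yv sE; subst v; rewrite rsym rxy mem_head; split=> //.
    by move: xs; rewrite inE negb_or => /andP[].
  rewrite last_rcons; move: isp; rewrite cat_rcons => isp; have := ipath_catr isp.
  move=> /= /and3P[wn /andP[/eqP rwv _] ->]; rewrite eqxx in rwv.
  rewrite rsym rwv !inE mem_cat mem_head !orbT; split=> //.
  by move: wn; rewrite inE negb_or => /andP[].
have [rvw wp ipv wC] := wE _ _ _ pE ip xp.
have [_ wq iqv wD] := wE _ _ _ qE iq xq.
(* Both tails end at [z], so their union connects [a] to [b]; as the paths are induced, [a] and [b]
   are the only neighbours of [v] in it. *)
pose A := [set c in a :: p'] :|: [set c in b :: q'].
have lpz : last a p' = z by rewrite -lp -[last y p]/(last y (y :: p)) pE last_cat.
have lqz : last b q' = z by rewrite -lq -[last y q]/(last y (y :: q)) qE last_cat.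
have con : connect (restrict r A) a b.
  apply: (@connect_trans _ _ z).
    rewrite -lpz; apply: ipath_connect; first by case/and3P: ipv.
    by move=> c cp'; rewrite !inE; move: cp'; rewrite inE => ->.
  rewrite restrict_connect_sym // -lqz; apply: ipath_connect; first by case/and3P: iqv.
  by move=> c cp'; rewrite !inE; move: cp'; rewrite inE => ->; rewrite orbT.
have rva : r v a by move: ipv => /= /and3P[_ /andP[/eqP-> _] _]; rewrite eqxx.
have rvb : r v b by move: iqv => /= /and3P[_ /andP[/eqP-> _] _]; rewrite eqxx.
have aA : a \in A by rewrite !inE eqxx.
have [|E EC [vE aE bE _]] := connect_chordless rsym rirr rva rvb ab aA con.
  move=> c; rewrite 3!inE => /orP[cp'|cq'].
    move: ipv => /and3P[vn /allP/(_ c cp')/eqP/= -> _]; split.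
      by apply: contraNneq vn => <-.
    by move=> /eqP; left.
  move: iqv => /and3P[vn /allP/(_ c cq')/eqP/= -> _]; split.
    by apply: contraNneq vn => <-.
  by move=> /eqP; right.
have oab := oalt EC vE aE bE rva rvb ab.
have wva : o v w = ~~ o v a.
  apply: (@oalt C) => //; rewrite ?CE ?[_ \in [set _ | _]]inE //.
  - by rewrite inE pE mem_cat mem_head !orbT.
  - by rewrite inE pE mem_cat !inE eqxx !orbT.
  - by apply: contraNneq wp => ->; rewrite mem_head.
have wvb : o v w = ~~ o v b.
  apply: (@oalt D) => //; rewrite ?DE ?[_ \in [set _ | _]]inE //.
  - by rewrite inE qE mem_cat mem_head !orbT.
  - by rewrite inE qE mem_cat !inE eqxx !orbT.
  - by apply: contraNneq wq => ->; rewrite mem_head.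
by move: wvb; rewrite wva oab; case: (o v b).
Qed.

Lemma alternating_restrict (A : {set T}) : alternating (restrict r A) o.
Proof.
move=> C x y z; rewrite chordless_restrict // => /andP[CC _] xC yC zC.
by move=> /and3P[rxy _ _] /and3P[rxz _ _]; apply: (@oalt C).
Qed.

(** Three neighbours of [x] would give three pairwise opposite directions. Hence both cycles use the
    same two neighbours of [x], and [alternating_chordless_inj] applies. *)
Lemma alternating_single_cycle x (C D : {set T}) :
  cycle_simplicial r x ->
  C \in chordless r -> D \in chordless r -> x \in C -> x \in D -> C = D.
Proof.
move=> good CC DC xC xD.
have opp a b : r x a -> r x b -> a != b -> o x a = ~~ o x b.
  move=> rxa rxb ab; have [E EC [xE aE bE]] := good a b rxa rxb ab.
  exact: oalt EC xE aE bE rxa rxb ab.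
have [y [z [yz yC zC rC]]] := chordless_nbrs rsym rirr CC xC.
have [y' [z' [yz' yD zD rD]]] := chordless_nbrs rsym rirr DC xD.
have rxy : r x y by rewrite rC // eqxx.
have rxz : r x z by rewrite rC // eqxx orbT.
have memD u : r x u -> u \in D.
  move=> rxu; have rxy' : r x y' by rewrite rD // eqxx.
  have rxz' : r x z' by rewrite rD // eqxx orbT.
  have [->//|uy'] := eqVneq u y'; have [->//|uz'] := eqVneq u z'.
  have := opp _ _ rxu rxy' uy'; rewrite (opp _ _ rxu rxz' uz').
  by rewrite (opp _ _ rxy' rxz' yz'); case: (o x z').
by apply: (@alternating_chordless_inj C D x y z) => //; split=> //; apply: memD.
Qed.

End Oriented.

(* The injective weight [w] stands for the linear order on the edges. *)
Lemma alternating_weight (T : finType) (r o : rel T) :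
  symmetric r -> irreflexive r -> alternating r o ->
  exists2 w : {set T} -> nat, injective w &
    forall (C D e : {set T}), C \in chordless r -> D \in chordless r -> C != D ->
      e \in edge_sets r -> e \subset C -> e \subset D ->
      {in edge_sets r, forall f : {set T}, f \subset C -> w f <= w e} ->
      {in edge_sets r, forall f : {set T}, f \subset D -> w f <= w e} -> False.
Proof.
have [n] := ubnP #|nonisolated r|; elim: n r => // n IH r /ltnSE-rn rsym rirr oalt.
have [r0|/(cycle_simplicial_vertex rsym rirr)[x xr good]] :=
    eqVneq (nonisolated r) set0.
  exists (fun e => nat_of_ord (enum_rank e)); first by move=> e f /val_inj/enum_rank_inj.
  by move=> C D e _ _ _ /edge_setsP[u [v []]]; rewrite (nonisolated0 _ _ r0).
have [||||w winj wP] := IH (restrict r [set~ x]).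
- by apply: leq_trans (nonisolated_del xr) rn.
- exact: restrict_symmetric.
- exact: restrict_irreflexive.
- exact: alternating_restrict.
pose K := (\max_(e : {set T}) w e).+1.
have wK e : w e < K by rewrite ltnS; apply: (leq_bigmax e).
(* Edges at [x] are lifted above all others by a common shift, which preserves injectivity. *)
pose w' (e : {set T}) := if x \in e then w e + K else w e.
have w'top (C e : {set T}) : C \in chordless r -> x \in C ->
    {in edge_sets r, forall f : {set T}, f \subset C -> w' f <= w' e} ->
    x \in e.
  move=> CC xC /= h; have [y [z [_ yC _ rC]]] := chordless_nbrs rsym rirr CC xC.
  have /h : [set x; y] \in edge_sets r.
    by apply/edge_setsP; exists x, y; rewrite rC // eqxx.
  rewrite subUset !sub1set xC yC /w' !inE eqxx /= => /(_ isT).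
  by case: ifP => // _; have := wK e; lia.
exists w' => [e f|C D e CC DC CD ee eC eD maxC maxD].
  rewrite /w'; have := (wK e, wK f).
  by case: ifP; case: ifP => _ _ [? ?] h; apply: winj; lia.
have xCD : x \in C -> x \in D -> False.
  move=> xC xD; case/eqP: CD.
  exact: (alternating_single_cycle rsym rirr oalt good).
(* On a cycle through [x] the maximal edge contains [x]; being common to both cycles, it would put
   [x] on both. *)
have xnC : x \notin C.
  apply/negP=> xC; apply: (xCD xC); apply: (subsetP eD).
  exact: (w'top C e).
have xnD : x \notin D.
  apply/negP=> xD; apply: (xCD _ xD); apply: (subsetP eC).
  exact: (w'top D e).
have agr (E : {set T}) : x \notin E -> {in E &, restrict r [set~ x] =2 r}.
  by move=> xE; apply: restrict_in; rewrite subset_setC1.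
have w'E (E f : {set T}) : x \notin E -> f \subset E -> w' f = w f.
  move=> xE fE; rewrite /w' ifN //; apply: contra xE; exact: (subsetP fE).
have CC' : C \in chordless (restrict r [set~ x]) by rewrite chordless_del // CC.
have DC' : D \in chordless (restrict r [set~ x]) by rewrite chordless_del // DC.
apply: (wP C D e CC' DC' CD _ eC eD).
- by rewrite (edge_sets_agree (agr C xnC) eC).
- move=> f fe fC; rewrite -(w'E C f) // -(w'E C e) //; apply: maxC => //.
  by rewrite -(edge_sets_agree (agr C xnC) fC).
- move=> f fe fD; rewrite -(w'E D f) // -(w'E D e) //; apply: maxD => //.
  by rewrite -(edge_sets_agree (agr D xnD) fD).
Qed.

Local Open Scope ring_scope.

(** * Edge functions modulo 2 *)

Lemma addF2 (a : 'F_2) : a + a = 0.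
Proof. exact/addrr_pchar2/pchar_Fp. Qed.

Definition cycle_sum (T : finType) (r : rel T) (c : {set T} -> 'F_2)
    (C : {set T}) : 'F_2 :=
  \sum_(e in edge_sets r | e \subset C) c e.

(* The indicator functions of the edge sets of the chordless cycles are
   linearly independent, in dual form. *)
Definition independent (T : finType) (r : rel T) : Prop :=
  forall D : {set T} -> 'F_2, exists c : {set T} -> 'F_2,
    {in chordless r, forall C, cycle_sum r c C = D C}.

Lemma cycle_sum_agree (T : finType) (r r' : rel T) (c c' : {set T} -> 'F_2)
    (C : {set T}) :
  {in C &, r =2 r'} -> (forall e : {set T}, e \subset C -> c e = c' e) ->
  cycle_sum r c C = cycle_sum r' c' C.
Proof.
move=> rr' cc'; apply: eq_big => [e|e /andP[_ /cc']//].
by apply: andb_id2r => /(edge_sets_agree rr')->.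
Qed.

Lemma sum_pair (T : finType) (V : nmodType) (f : T -> V) (u v : T) : u != v ->
  \sum_(w in [set u; v]) f w = f u + f v.
Proof. by move=> uv; rewrite big_setU1 ?inE // big_set1. Qed.

Section Graph.
Variables (T : finType) (r : rel T).
Hypotheses (rsym : symmetric r) (rirr : irreflexive r).
Implicit Types (C : {set T}) (c : {set T} -> 'F_2).

Lemma star_sum (V : nmodType) (f : {set T} -> V) C x y z :
  C \in chordless r -> x \in C -> y \in C -> z \in C -> r x y -> r x z ->
  y != z ->
  \sum_(e in edge_sets r | (e \subset C) && (x \in e)) f e =
    f [set x; y] + f [set x; z].
Proof.
move=> CC xC yC zC rxy rxz yz.
have nb := chordless_nbr2 rsym rirr CC xC yC zC rxy rxz yz.
rewrite -(@sum_pair _ _ f); last first.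
  apply: contraNneq yz => /setP/(_ y); rewrite !inE eqxx orbT => /esym/orP[/eqP yx|//].
  by rewrite yx rirr in rxy.
apply: eq_bigl => e; rewrite !inE; apply/and3P/orP; last first.
  by case=> /eqP->; rewrite subUset !sub1set xC ?yC ?zC !inE eqxx; split=> //;
    apply/edge_setsP; exists x; [exists y|exists z].
have xnb u : r x u -> u \in C -> [set x; u] == [set x; y] \/ [set x; u] == [set x; z].
  by move=> rxu uC; move: rxu; rewrite nb // => /orP[]/eqP->; [left|right].
move=> [/edge_setsP[u [v [ruv ->]]]]; rewrite subUset !sub1set !inE.
move=> /andP[uC vC] /orP[]/eqP xE; subst; first exact: xnb.
by rewrite setUC; apply: xnb => //; rewrite rsym.
Qed.

(** Every vertex of [C] lies on exactly two edges of [C], so its value is counted twice. *)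
Lemma coboundary_cycle_sum (phi : T -> 'F_2) C : C \in chordless r ->
  cycle_sum r (fun e => \sum_(u in e) phi u) C = 0.
Proof.
move=> CC; rewrite /cycle_sum (exchange_big_dep (mem C)) /=; last first.
  by move=> e u /andP[_ /subsetP eC]; apply: eC.
apply: big1 => x xC; have [y [z [yz yC zC nb]]] := chordless_nbrs rsym rirr CC xC.
under eq_bigl => e do rewrite -andbA.
rewrite (star_sum (fun=> phi x) CC xC yC zC) ?addF2 //; by rewrite nb // eqxx ?orbT.
Qed.

(* Subtracting the coboundary of [phi] kills all the edges of [C] that avoid
   [x]. *)
Lemma local_cycle_sum (phi : T -> 'F_2) c C x y z :
  (forall u v, r u v -> u != x -> v != x -> c [set u; v] = phi u + phi v) ->
  C \in chordless r -> x \in C -> y \in C -> z \in C -> r x y -> r x z ->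
  y != z ->
  cycle_sum r c C = (c [set x; y] + phi y) + (c [set x; z] + phi z).
Proof.
move=> cphi CC xC yC zC rxy rxz yz.
have rne u v : r u v -> u != v by move=> ruv; apply: contraTneq ruv => ->; rewrite rirr.
rewrite -[LHS]addr0 -(coboundary_cycle_sum phi CC) /cycle_sum -big_split /=.
rewrite (bigID (fun e : {set T} => x \in e)) /= [X in _ + X]big1 ?addr0.
  under eq_bigl => e do rewrite -andbA.
  rewrite (star_sum _ CC xC yC zC) // !sum_pair ?rne //.
  by rewrite !addrA !(addrAC _ (phi x)) -!addrA addF2 addr0 addrCA !addrA.
move=> e /andP[/andP[/edge_setsP[u [v [ruv ->]]] _]]; rewrite !inE negb_or.
move=> /andP[xu xv]; by rewrite sum_pair ?rne // cphi ?addF2 // eq_sym.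
Qed.

End Graph.

(** * Potentials and consequences of linear independence *)

Section Potential.
Variable T : finType.
Implicit Types (r : rel T) (C : {set T}) (c : {set T} -> 'F_2).

Lemma cycle_sum_del r c C x : x \notin C ->
  cycle_sum (restrict r [set~ x]) c C = cycle_sum r c C.
Proof.
by move=> xC; apply: cycle_sum_agree => //; apply: restrict_in; rewrite subset_setC1.
Qed.

(** A potential on the graph without [x] extends: one edge at [x] prescribes the value there, and
    each other edge at [x] agrees because the chordless cycle through both has sum zero. *)
Lemma cycle_sum0_potential r c : symmetric r -> irreflexive r ->
  {in chordless r, forall C, cycle_sum r c C = 0} ->
  exists phi : T -> 'F_2, forall u v, r u v -> c [set u; v] = phi u + phi v.
Proof.
have [n] := ubnP #|nonisolated r|; elim: n r => // n IH r /ltnSE-rn rsym rirr c0.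
have [r0|/(cycle_simplicial_vertex rsym rirr)[x xr good]] :=
    eqVneq (nonisolated r) set0.
  by exists (fun=> 0) => u v; rewrite nonisolated0.
have [||||phi phiP] := IH (restrict r [set~ x]).
- by apply: leq_trans (nonisolated_del xr) rn.
- exact: restrict_symmetric.
- exact: restrict_irreflexive.
- by move=> C; rewrite chordless_del // => /andP[CC xC]; rewrite cycle_sum_del ?c0.
have {}phiP u v : r u v -> u != x -> v != x -> c [set u; v] = phi u + phi v.
  by move=> ruv ux vx; apply: phiP; rewrite /restrict /= ruv !inE ux vx.
have [y rxy] := nonisolatedP _ _ xr.
pose psi u := if u == x then c [set x; y] + phi y else phi u.
have psix z : r x z -> c [set x; z] = psi x + psi z.
  move=> rxz; have zx : z != x by apply: contraTneq rxz => ->; rewrite rirr.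
  rewrite /psi eqxx (negPf zx).
  have [->|zy] := eqVneq z y; first by rewrite -addrA addF2 addr0.
  have [C CC [xC zC yC]] := good z y rxz rxy zy.
  have := local_cycle_sum rsym rirr phiP CC xC zC yC rxz rxy zy.
  rewrite c0 // => /esym/eqP; rewrite addr_eq0 => /eqP/(congr1 (fun a => a + phi z)).
  rewrite -addrA addF2 addr0 => ->; congr (_ + _).
  by apply/eqP; rewrite eq_sym -addr_eq0 addF2.
exists psi => u v ruv.
have [ux|ux] := eqVneq u x; first by subst u; apply: psix.
have [vx|vx] := eqVneq v x; first by subst v; rewrite setUC addrC psix // rsym.
by rewrite /psi (negPf ux) (negPf vx) phiP.
Qed.

Lemma independent_del r x : symmetric r -> irreflexive r ->
  independent r -> independent (restrict r [set~ x]).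
Proof.
move=> rsym rirr ind D; have [c cP] := ind D; exists c => C.
by rewrite chordless_del // => /andP[CC xC]; rewrite cycle_sum_del ?cP.
Qed.

(** Take [c] with sum 1 on [C0] and 0 on the other chordless cycles. Since [C0] passes through [x],
    all sums vanish after deleting [x], so [c] has a potential there and [local_cycle_sum] leaves
    only the two edges at [x]. *)
Lemma independent_indicator r x (C0 : {set T}) : symmetric r -> irreflexive r ->
  independent r -> x \in C0 ->
  exists gamma : T -> 'F_2, forall (C : {set T}) y z, C \in chordless r ->
    x \in C -> y \in C -> z \in C -> r x y -> r x z -> y != z ->
    gamma y + gamma z = (C == C0)%:R.
Proof.
move=> rsym rirr ind xC0; have [c cP] := ind (fun C => (C == C0)%:R).
have [|||phi phiP] := @cycle_sum0_potential (restrict r [set~ x]) c.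
- exact: restrict_symmetric.
- exact: restrict_irreflexive.
- move=> C; rewrite chordless_del // => /andP[CC xC]; rewrite cycle_sum_del ?cP //.
  by case: eqP xC => // ->; rewrite xC0.
exists (fun y => c [set x; y] + phi y) => C y z CC xC yC zC rxy rxz yz.
rewrite -cP // -(local_cycle_sum rsym rirr _ CC) // => u v ruv ux vx.
by apply: phiP; rewrite /restrict /= ruv !inE ux vx.
Qed.

Section SimplicialVertex.
Variables (r : rel T) (x : T).
Hypotheses (rsym : symmetric r) (rirr : irreflexive r) (ind : independent r).
Hypothesis (good : cycle_simplicial r x).

(** The cycle [C] through [y] and [z] misses [w], so it differs from the cycles through [w]. The
    indicator of [C] then gives [g y = g w = g z] modulo 2, whereas [g y + g z] is 1. *)
Lemma independent_degree y z w :
  r x y -> r x z -> r x w -> y != z -> w != y -> w != z -> False.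
Proof.
move=> rxy rxz rxw yz wy wz.
have [C CC [xC yC zC]] := good rxy rxz yz.
have [D DC [xD wD yD]] := good rxw rxy wy.
have [E EC [xE wE zE]] := good rxw rxz wz.
have wnC : w \notin C.
  apply/negP=> wC; have := chordless_nbr2 rsym rirr CC xC yC zC rxy rxz yz wC.
  by rewrite rxw (negPf wy) (negPf wz).
have [g gP] := independent_indicator rsym rirr ind xC.
have DC0 : D != C by apply: contraNneq wnC => <-.
have EC0 : E != C by apply: contraNneq wnC => <-.
have := gP _ _ _ CC xC yC zC rxy rxz yz; rewrite eqxx.
have /eqP := gP _ _ _ DC xD wD yD rxw rxy wy; rewrite (negPf DC0) addr_eq0 => /eqP gy.
have /eqP := gP _ _ _ EC xE wE zE rxw rxz wz; rewrite (negPf EC0) addr_eq0 gy => /eqP/oppr_inj->.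
by rewrite addF2.
Qed.

(** By the degree bound both cycles use the same two neighbours of [x], so the indicator of [C]
    takes the same value on both. *)
Lemma independent_single_cycle (C D : {set T}) :
  C \in chordless r -> D \in chordless r -> x \in C -> x \in D -> C = D.
Proof.
move=> CC DC xC xD.
have [y [z [yz yC zC rC]]] := chordless_nbrs rsym rirr CC xC.
have [y' [z' [yz' yD zD rD]]] := chordless_nbrs rsym rirr DC xD.
have rxy : r x y by rewrite rC // eqxx.
have rxz : r x z by rewrite rC // eqxx orbT.
have memD u : r x u -> u \in D.
  move=> rxu; have rxy' : r x y' by rewrite rD // eqxx.
  have rxz' : r x z' by rewrite rD // eqxx orbT.
  have [->//|uy'] := eqVneq u y'; have [->//|uz'] := eqVneq u z'.
  by have := independent_degree rxy' rxz' rxu yz' uy' uz'.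
have [g gP] := independent_indicator rsym rirr ind xC.
have := gP _ _ _ DC xD (memD y rxy) (memD z rxz) rxy rxz yz.
rewrite (gP _ _ _ CC xC yC zC rxy rxz yz) eqxx.
by case: eqP.
Qed.

End SimplicialVertex.
End Potential.

(** * Suppressing a vertex of degree two *)

Lemma ipath_agree (T : finType) (r r' : rel T) (s : seq T) :
  {in s &, r =2 r'} -> ipath r s = ipath r' s.
Proof.
elim: s => //= a q IH rr'; rewrite IH; last first.
  by move=> u v uq vq; apply: rr'; rewrite inE ?uq ?vq orbT.
congr [&& _, _ & _]; apply: eq_in_all => u uq.
by rewrite rr' // !inE ?eqxx // uq orbT.
Qed.

Lemma orients_opp (T : finType) (r o : rel T) u v :
  orients r o -> r u v -> o v u = ~~ o u v.
Proof.
move=> [oor oasym]; rewrite oor; have := @oasym u v.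
by case: (o u v) => [/(_ isT)/negPf->|_ /= ->].
Qed.

(* The edge [{x, y}] is directed towards [x], and [{x, z}] away from [x], iff
   [b] holds. *)
Definition extend_orientation (T : finType) (r o : rel T) (x y z : T) (b : bool) :
    rel T :=
  fun u v => if u == x then (if v == y then ~~ b else (v == z) && b)
    else if v == x then (if u == y then b else (u == z) && ~~ b)
    else r u v && o u v.

Section Extend.
Variables (T : finType) (r o : rel T) (x y z : T) (b : bool).
Hypotheses (rsym : symmetric r) (rirr : irreflexive r).
Hypothesis (rx : forall u, r x u = (u == y) || (u == z)).
Hypothesis (ro : forall u v, r u v -> u != x -> v != x -> o u v || o v u).
Hypothesis (oasym : forall u v, o u v -> ~~ o v u).

Let ext := extend_orientation r o x y z b.

(** The case [y = z] is included; it serves a vertex [x] of degree one. *)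
Lemma extend_orients : orients r ext.
Proof.
have yx : y != x by apply/negP=> /eqP E; have := rx y; rewrite eqxx E rirr.
have zx : z != x by apply/negP=> /eqP E; have := rx z; rewrite eqxx orbT E rirr.
split=> u v; rewrite /ext /extend_orientation.
  have [->|ux] := eqVneq u x; have [->|vx] := eqVneq v x.
  - by rewrite rirr ![x == _]eq_sym (negPf yx) (negPf zx).
  - by rewrite rx; case: (v == y); case: (v == z); case: b.
  - by rewrite rsym rx; case: (u == y); case: (u == z); case: b.
  - rewrite [r v u]rsym; case ruv: (r u v) => //=.
    by rewrite ro.
have [ux|ux] := eqVneq u x; have [vx|vx] := eqVneq v x; rewrite ?ux ?vx.
- by rewrite ![x == _]eq_sym (negPf yx) (negPf zx).
- by case: (v == y); case: (v == z); case: b.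
- by case: (u == y); case: (u == z); case: b.
- by move=> /andP[_ /oasym/negPf->]; rewrite andbF.
Qed.

Lemma extend_orientation_out u : u != x -> r u x ->
  ext u x = if u == y then b else ~~ b.
Proof.
move=> ux; rewrite rsym rx /ext /extend_orientation (negPf ux) eqxx.
by case: eqP => //= _ ->.
Qed.

Lemma extend_orientation_in u v : u != x -> v != x -> r u v -> ext u v = o u v.
Proof. by move=> ux vx ruv; rewrite /ext /extend_orientation (negPf ux) (negPf vx) ruv. Qed.

Lemma extend_alternates_at s t : r x s -> r x t -> s != t -> ext x s = ~~ ext x t.
Proof.
rewrite !rx /ext /extend_orientation eqxx => /orP[]/eqP-> /orP[]/eqP->; rewrite ?eqxx //.
- by rewrite eq_sym => /negPf->.
- by move=> /negPf->; rewrite negbK.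
Qed.

End Extend.

(** The path through [x] becomes a single edge, and [x] remains as an isolated vertex. *)
Definition suppress (T : finType) (r : rel T) (x y z : T) : rel T :=
  fun u v => restrict r [set~ x] u v || ((u == y) && (v == z) || (u == z) && (v == y)).

Section Suppress.
Variables (T : finType) (r : rel T) (x y z : T).
Hypotheses (rsym : symmetric r) (rirr : irreflexive r).
Hypothesis (rx : forall u, r x u = (u == y) || (u == z)).
Hypotheses (yz : y != z) (ryz : ~~ r y z).

Local Notation r' := (suppress r x y z).

Let yx : y != x.
Proof. by apply/negP=> /eqP E; have := rx y; rewrite eqxx E rirr. Qed.

Let zx : z != x.
Proof. by apply/negP=> /eqP E; have := rx z; rewrite eqxx orbT E rirr. Qed.

Lemma suppress_sym : symmetric r'.
Proof.
move=> u v; rewrite /suppress restrict_symmetric //; congr (_ || _).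
by rewrite orbC [_ && (u == y)]andbC [_ && (u == z)]andbC.
Qed.

Lemma suppress_irr : irreflexive r'.
Proof.
move=> u; rewrite /suppress restrict_irreflexive //=.
rewrite [X in _ || X]andbC orbb; apply/negP=> /andP[/eqP->].
by rewrite (negPf yz).
Qed.

Lemma suppress_adj u v : u != x -> v != x -> r u v -> r' u v.
Proof. by move=> ux vx ruv; rewrite /suppress /restrict /= !inE ruv ux vx. Qed.

Lemma suppress_yz : r' y z.
Proof. by rewrite /suppress !eqxx orbT. Qed.

Lemma suppress_agree (C : {set T}) : x \notin C -> ~~ ((y \in C) && (z \in C)) ->
  {in C &, r' =2 r}.
Proof.
move=> xC yzC u v uC vC; rewrite /suppress /restrict /= !inE.
have -> : u != x by apply: contraNneq xC => <-.
have -> : v != x by apply: contraNneq xC => <-.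
rewrite !andbT; case: (boolP (_ || _ && _)) => [|_]; rewrite ?orbF //.
by move=> /orP[]/andP[/eqP uE /eqP vE]; move: yzC; rewrite -uE -vE uC vC.
Qed.

Lemma suppress_notin (C : {set T}) : C \in chordless r' -> x \notin C.
Proof.
move=> CC; apply/negP=> xC.
have [a [b [_ aC _ nb]]] := chordless_nbrs suppress_sym suppress_irr CC xC.
have := nb a aC; rewrite eqxx /suppress /restrict /= !inE eqxx andbF /=.
by rewrite ![x == _]eq_sym (negPf yx) (negPf zx).
Qed.

(** Both cycles come from one induced path from [y] to [z]: it is closed by the new edge on the left
    and by [x] on the right. *)
Lemma suppress_cycle (C : {set T}) : x \notin C -> y \in C -> z \in C ->
  (C \in chordless r') = (x |: C \in chordless r).
Proof.
move=> xC yC zC.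
have agree (s : seq T) : x \notin s -> y \notin s -> {in s &, r' =2 r}.
  move=> xs ys u v us vs; apply: (@suppress_agree [set w in s]); rewrite ?inE //.
  by rewrite (negPf ys).
have r'y u : u != x -> r' y u = r y u || (u == z).
  move=> ux; rewrite /suppress /restrict /= !inE yx ux !andbT eqxx (negPf yz) /=.
  by rewrite orbF.
apply/idP/idP => CC.
  have [a [a' [aa' aC a'C nb]]] := chordless_nbrs suppress_sym suppress_irr CC yC.
  wlog a'z : a a' aa' aC a'C nb / a' = z => [wl|].
    have := nb z zC; rewrite suppress_yz => /esym/orP[]/eqP az.
      apply: (wl a' a) => //; first by rewrite eq_sym.
      by move=> u uC; rewrite nb // orbC.
    exact: (wl a a').
  subst a'; have r'ya : r' y a by rewrite nb // eqxx.
  have [p [cp CE lp]] :=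
    chordless_cyc_from suppress_sym suppress_irr CC yC aC zC r'ya suppress_yz aa'.
  have [yp _ ip _] := and4P cp.
  have -> : x |: C = [set u in x :: y :: a :: p].
    by rewrite CE; apply/setP=> u; rewrite !inE.
  apply: cyc_at_chordless => //; rewrite /cyc_at.
  have xp : x \notin y :: a :: p by move: xC; rewrite CE inE.
  have [_ xp'] : x != y /\ x \notin a :: p by apply/andP; rewrite -negb_or -in_cons.
  apply/and4P; split=> //; last by apply/allP=> u _ /=; rewrite lp rx.
  apply/and3P; split=> //; last by move: ip; rewrite (ipath_agree (agree _ xp' yp)).
  apply/allP=> u up /=; have uC : u \in C by rewrite CE inE inE up orbT.
  have ux : u != x by apply: contraNneq xC => <-.
  have := nb u uC; rewrite r'y //; have [->|uz] := eqVneq u z.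
    by move=> _; rewrite (negPf ryz) [z == a]eq_sym (negPf aa').
  by rewrite !orbF => ->.
have xC' : x \in x |: C by rewrite !inE eqxx.
have yC' : y \in x |: C by rewrite !inE yC orbT.
have zC' : z \in x |: C by rewrite !inE zC orbT.
have rxy : r x y by rewrite rx eqxx.
have rxz : r x z by rewrite rx eqxx orbT.
have [p [cp CE lp]] := chordless_cyc_from rsym rirr CC xC' yC' zC' rxy rxz yz.
have [xp _ ip _] := and4P cp.
have {}CE : C = [set u in y :: p].
  rewrite -(setU1K xC) CE; apply/setP=> u; rewrite in_setD1 !in_set in_cons.
  by case: eqP => // ->; rewrite (negPf xp).
rewrite CE; apply: (cyc_at_chordless suppress_sym suppress_irr).
case: p ip lp xp CE {cp} => [|a p]; first by move=> _ /eqP; rewrite (negPf yz).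
move=> ipy lp; rewrite inE negb_or => /andP[_ xp] CE.
have /and3P[yp ya _] := ipy; have ip : ipath r (a :: p) by case/and3P: ipy.
rewrite /cyc_at yp (ipath_agree (agree _ xp yp)) ip andTb; apply/and3P; split=> //.
  (* Were [z] the only vertex besides [y], the path would make [y] and [z] adjacent; so the short
     cycle still has at least three vertices. *)
  case: p lp ya {ip ipy yp xp CE} => //= az; rewrite az andbT => /eqP.
  by rewrite (negPf ryz) eqxx.
apply/allP=> u up /=; move: (lp) => /= ->.
have ux : u != x by apply: contraNneq xp => <-.
by rewrite r'y // (eqP (allP ya u up)).
Qed.

Hypothesis single : forall C D : {set T},
  C \in chordless r -> D \in chordless r -> x \in C -> x \in D -> C = D.

(** The arc of [C] from [a] to [z] avoiding [b], together with [x], connects [x] to [a] and contains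
    no other neighbour of [y]; [connect_chordless] at [y] yields [D]. *)
Lemma shortcut_cycle (C : {set T}) a b : C \in chordless r ->
  x \notin C -> y \in C -> z \in C -> a \in C -> b \in C -> r y a -> r y b ->
  a != b ->
  exists2 D, D \in chordless r & [/\ x \in D, a \in D & b \notin D].
Proof.
move=> CC xC yC zC aC bC rya ryb ab.
have [p [cp CE lp]] := chordless_cyc_from rsym rirr CC yC aC bC rya ryb ab.
have [yp _ ip _] := and4P cp.
have za : z != a by apply: contraNneq ryz => ->.
have zb : z != b by apply: contraNneq ryz => ->.
have zp : z \in p by move: zC; rewrite CE !inE eq_sym (negPf yz) (negPf za).
have [p1 [p2 pE]] : exists p1 p2, p = rcons p1 z ++ p2.
  by case/path.splitP: zp => p1 p2; exists p1, p2.
pose q := a :: rcons p1 z.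
have apE : a :: p = q ++ p2 by rewrite pE.
have iq : ipath r q by apply: (ipath_catl rsym rirr (s2 := p2)); rewrite -apE.
have bq : b \notin q.
  have bp2 : b \in p2.
    move: lp; rewrite pE last_cat last_rcons; case: (p2) => [/eqP|c s <-].
      by rewrite (negPf zb).
    exact: (mem_last c s).
  have := ipath_uniq rsym rirr ip; rewrite apE cat_uniq => /and3P[_ /hasPn h _].
  exact: h.
have qp u : u \in q -> u \in a :: p by move=> uq; rewrite apE mem_cat uq.
pose A := x |: [set u in q].
have zq : z \in q by rewrite inE mem_rcons mem_head orbT.
have xA : x \in A by rewrite !inE eqxx.
have zA : z \in A by rewrite in_setU1 in_set zq orbT.
have con : connect (restrict r A) x a.
  apply: (@connect_trans _ _ z).
    by apply: connect1; rewrite /restrict /= rx xA zA eqxx orbT.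
  rewrite restrict_connect_sym //.
  have -> : z = last a (rcons p1 z) by rewrite last_rcons.
  by apply: ipath_connect => // u uq; rewrite in_setU1 in_set uq orbT.
have ryx : r y x by rewrite rsym rx eqxx.
have xa : x != a by apply: contraNneq xC => ->.
have [|D DC [yD xD aD /subsetP DA]] := connect_chordless rsym rirr ryx rya xa xA con.
  move=> u; rewrite in_setU1 in_set => /orP[/eqP->|uq].
    by split; [rewrite eq_sym|left].
  have uC : u \in C by rewrite CE in_set in_cons (qp _ uq) orbT.
  split; first by apply: contraNneq yp => <-; apply: qp.
  rewrite (chordless_nbr2 rsym rirr CC yC aC bC rya ryb ab uC).
  move=> /orP[/eqP->|/eqP uE]; first by right.
  by rewrite uE (negPf bq) in uq.
exists D => //; split=> //; apply: contraNN bq => /DA; rewrite !in_setU1 in_set.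
move=> /or3P[/eqP bE|/eqP bE|//]; first by rewrite bE rirr in ryb.
by rewrite bE (negPf xC) in bC.
Qed.

(** Otherwise shortcuts through [x] along the two arcs of [C] would be two chordless cycles through
    [x], told apart by [b]. *)
Lemma single_no_chord (C : {set T}) : C \in chordless r -> x \notin C ->
  ~~ ((y \in C) && (z \in C)).
Proof.
move=> CC xC; apply/negP=> /andP[yC zC].
have [a [b [ab aC bC nb]]] := chordless_nbrs rsym rirr CC yC.
have rya : r y a by rewrite nb // eqxx.
have ryb : r y b by rewrite nb // eqxx orbT.
have [D DC [xD _ bD]] := shortcut_cycle CC xC yC zC aC bC rya ryb ab.
have [|E EC [xE bE _]] := shortcut_cycle CC xC yC zC bC aC ryb rya.
  by rewrite eq_sym.
by rewrite (single DC EC xD xE) bE in bD.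
Qed.

Lemma suppress_single (C D : {set T}) : C \in chordless r' -> D \in chordless r' ->
  y \in C -> z \in C -> y \in D -> z \in D -> C = D.
Proof.
move=> CC DC yC zC yD zD.
have [xC xD] := (suppress_notin CC, suppress_notin DC).
rewrite -(setU1K xC) -(setU1K xD); congr (_ :\ _).
by apply: single; rewrite -?suppress_cycle // !inE eqxx.
Qed.

(** Cycles missing [y] or [z] are the same in both graphs. At most one cycle uses the new edge, and
    the value there is free to satisfy its equation. *)
Lemma independent_suppress : independent r -> independent r'.
Proof.
move=> ind D; have [c cP] := ind D.
pose yzC (C : {set T}) := (y \in C) && (z \in C).
(* The default 0 is taken when no chordless cycle uses the new edge. *)
pose v := if [pick C in chordless r' | yzC C] is Some C then
  (D C - \sum_(e in edge_sets r' | (e \subset C) && (e != [set y; z])) c e)%R else 0%R.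
pose c' (e : {set T}) := if e == [set y; z] then v else c e.
exists c' => C CC; have xC := suppress_notin CC.
have [yzin|nyz] := boolP (yzC C); last first.
  have rr' := suppress_agree xC nyz.
  have CC' : C \in chordless r by rewrite -(chordless_agree rr').
  rewrite -cP //; apply: cycle_sum_agree => // e eC.
  rewrite /c' ifN //; apply: contraNneq nyz => eE.
  by move: eC; rewrite eE subUset !sub1set.
have [yC zC] := andP yzin.
have yze : ([set y; z] \in edge_sets r') && ([set y; z] \subset C).
  rewrite subUset !sub1set yC zC !andbT.
  by apply/edge_setsP; exists y, z; split=> //; apply: suppress_yz.
rewrite /cycle_sum (bigD1 [set y; z]) //= {1}/c' eqxx.
have -> : v = (D C - \sum_(e in edge_sets r' | (e \subset C) && (e != [set y; z])) c e)%R.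
  rewrite /v; case: pickP => [E /andP[EC /andP[yE zE]]|/(_ C)].
    by rewrite (suppress_single EC CC).
  by rewrite CC yzin.
under [X in (_ + X)%R]eq_bigl => e do rewrite -andbA.
rewrite [X in (_ + X)%R](eq_bigr c) ?subrK // => e /and3P[_ _ /negPf ne].
by rewrite /c' ne.
Qed.

(** The path through [x] is directed like the edge it subdivides. Cycles avoiding [x] survive by
    [single_no_chord], and those through [x] come from cycles through the new edge. *)
Lemma alternating_suppress (o : rel T) : orients r' o -> alternating r' o ->
  alternating r (extend_orientation r o x y z (o y z)).
Proof.
move=> oor oalt C v s t CC vC sC tC rvs rvt st.
set ext := extend_orientation _ _ _ _ _ _.
have extE := @extend_orientation_in T r o x y z (o y z).
have ozy : o z y = ~~ o y z := orients_opp oor suppress_yz.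
have [vx|vx] := eqVneq v x; first by rewrite vx in rvs rvt *; apply: extend_alternates_at.
have neq u : u \in C -> x \notin C -> u != x by move=> uC; apply: contraNneq => <-.
have [xC|xC] := boolP (x \in C); last first.
  have [sx tx] := (neq s sC xC, neq t tC xC).
  have rr' := suppress_agree xC (single_no_chord CC xC).
  rewrite /ext !extE //; apply: (oalt C); rewrite ?(chordless_agree rr') //.
    exact: suppress_adj.
  exact: suppress_adj.
have [yC zC] : y \in C /\ z \in C.
  have [a [b [ab aC bC nb]]] := chordless_nbrs rsym rirr CC xC.
  have := (nb a aC, nb b bC); rewrite !rx !eqxx orbT.
  by case=> /orP[]/eqP aE /orP[]/eqP bE; subst => //; rewrite eqxx in ab.
pose C' := C :\ x.
have inC' u : u != x -> u \in C -> u \in C' by rewrite !inE => -> ->.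
have CC' : C' \in chordless r'.
  have xC' : x \notin C' by rewrite !inE eqxx.
  by rewrite suppress_cycle ?(inC' y) ?(inC' z) // /C' setD1K.
have away u w : u != x -> w != x -> u \in C -> w \in C -> r v u -> r v w -> u != w ->
    ext v u = ~~ ext v w.
  move=> ux wx uC wC rvu rvw uw; rewrite /ext !extE //.
  by apply: (oalt C'); rewrite ?inC' ?suppress_adj.
(* At [y] or [z], the edge to [x] has the direction of the new edge. *)
have toward u : u != x -> u \in C -> r v x -> r v u -> ext v x = ~~ ext v u.
  move=> ux uC rvx rvu.
  rewrite /ext (extend_orientation_out _ _ rsym rx) // extE //.
  have r'vu : r' v u by apply: suppress_adj.
  move: rvx; rewrite rsym rx => /orP[]/eqP vE; subst v.
    rewrite eqxx; apply: (oalt C'); rewrite ?inC' ?suppress_yz //.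
    by apply: contraNneq ryz => ->.
  rewrite eq_sym (negPf yz) -ozy; apply: (oalt C'); rewrite ?inC' //.
    by rewrite suppress_sym suppress_yz.
  by apply: contraNneq ryz => ->; rewrite rsym.
have [sx|sx] := eqVneq s x.
  by subst s; apply: toward => //; rewrite eq_sym.
have [tx|tx] := eqVneq t x; last exact: away.
by subst t; rewrite (toward s) ?negbK.
Qed.

Lemma nonisolated_suppress : (#|nonisolated r'| < #|nonisolated r|)%N.
Proof.
apply/proper_card/properP; split.
  apply/subsetP=> u /nonisolatedP[v]; rewrite /suppress => /orP[/and3P[ruv _ _]|].
    by apply/nonisolatedP; exists v.
  move=> h; apply/nonisolatedP; exists x; rewrite rsym rx.
  by case/orP: h => /andP[-> _]; rewrite ?orbT.
exists x; first by apply/nonisolatedP; exists y; rewrite rx eqxx.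
apply/nonisolatedP => -[v]; rewrite /suppress /restrict /= !inE eqxx andbF.
by rewrite ![x == _]eq_sym (negPf yx) (negPf zx).
Qed.

End Suppress.

(** The vertex [x] has one or two neighbours. It is deleted if it has one, or if its two neighbours
    are adjacent, and suppressed otherwise. *)
Lemma independent_alternating (T : finType) (r : rel T) :
  symmetric r -> irreflexive r -> independent r ->
  exists2 o, orients r o & alternating r o.
Proof.
have [n] := ubnP #|nonisolated r|; elim: n r => // n IH r /ltnSE-rn rsym rirr ind.
have [r0|/(cycle_simplicial_vertex rsym rirr)[x xr good]] :=
    eqVneq (nonisolated r) set0.
  exists r; first by split=> u v; rewrite !(nonisolated0 _ _ r0).
  by move=> C u v w _ _ _ _; rewrite (nonisolated0 _ _ r0).
have [y rxy] := nonisolatedP _ _ xr.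
have single := independent_single_cycle rsym rirr ind good.
have [||||o oor oalt] := IH (restrict r [set~ x]).
- by apply: leq_trans (nonisolated_del xr) rn.
- exact: restrict_symmetric.
- exact: restrict_irreflexive.
- exact: independent_del.
have ro u v : r u v -> u != x -> v != x -> o u v || o v u.
  by move=> ruv ux vx; rewrite -oor.1 /restrict /= !inE ruv ux vx.
have alt_away z b (C : {set T}) v s t : x \notin C -> C \in chordless r ->
    v \in C -> s \in C -> t \in C -> r v s -> r v t -> s != t ->
    extend_orientation r o x y z b v s = ~~ extend_orientation r o x y z b v t.
  move=> xC CC vC sC tC rvs rvt st.
  have neq u : u \in C -> u != x by move=> uC; apply: contraNneq xC => <-.
  have CC' : C \in chordless (restrict r [set~ x]) by rewrite chordless_del // CC.
  rewrite !extend_orientation_in ?neq //.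
  by apply: (oalt C) => //; rewrite /restrict /= !inE ?rvs ?rvt !neq.
case: (pickP [pred u | r x u && (u != y)]) => [z /= /andP[rxz zy]|noz]; last first.
  (* A vertex of degree one lies on no chordless cycle, so its edge may be directed either way. *)
  have rx u : r x u = (u == y) || (u == y).
    rewrite orbb; have /= := noz u; have [->|uy] := eqVneq u y => //.
    by rewrite andbT.
  exists (extend_orientation r o x y y true).
    by apply: extend_orients => //; exact: oor.2.
  move=> C v s t CC; apply: alt_away => //; apply/negP=> xC.
  have [a [b [ab aC bC nb]]] := chordless_nbrs rsym rirr CC xC.
  have := (nb a aC, nb b bC); rewrite !rx !orbb !eqxx orbT => -[/eqP aE /eqP bE].
  by rewrite aE bE eqxx in ab.
have rx u : r x u = (u == y) || (u == z).
  have [->|uy] := eqVneq u y => //=; have [->|uz] := eqVneq u z => //=.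
  apply/negP=> rxu; apply: (independent_degree rsym rirr ind good rxy rxz rxu) => //.
  by rewrite eq_sym.
have yz : y != z by rewrite eq_sym.
have [ryz|nryz] := boolP (r y z); last first.
  have [||||o' oor' oalt'] := IH (suppress r x y z).
  - by apply: leq_trans (nonisolated_suppress rsym rirr rx) rn.
  - exact: suppress_sym.
  - exact: suppress_irr.
  - exact: independent_suppress.
  exists (extend_orientation r o' x y z (o' y z)); last exact: alternating_suppress.
  apply: extend_orients => //; last exact: oor'.2.
  by move=> u v ruv ux vx; rewrite -oor'.1; apply: suppress_adj.
have [yx zx] : y != x /\ z != x.
  by split; [apply: contraTneq rxy | apply: contraTneq rxz] => ->; rewrite rirr.
have ozy : o z y = ~~ o y z.
  by apply: (orients_opp oor); rewrite /restrict /= ryz !inE yx zx.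
(* When [y] and [z] are adjacent, the only chordless cycle through [x] is the triangle. *)
have sub (C : {set T}) : C \in chordless r -> x \in C -> C \subset [set x; y; z].
  move=> CC xC; have yA : y \in [set y; z] by rewrite !inE eqxx.
  have [||D DC [xD _ _ DA]] := connect_chordless rsym rirr rxy rxz yz yA.
  - by apply: connect1; rewrite /restrict /= ryz !inE !eqxx orbT.
  - by move=> u; rewrite !inE => /orP[]/eqP->; split=> //; [left|right].
  by rewrite (single C D) // -setUA.
(* With [o z y] the triangle runs from [z] to [y] to [x] and back to [z]; otherwise it runs the
   opposite way. *)
exists (extend_orientation r o x y z (o z y)); first by apply: extend_orients => //; exact: oor.2.
move=> C v s t CC vC sC tC rvs rvt st.
have [xC|xC] := boolP (x \in C); last exact: (alt_away z _ C).
have CA := subsetP (sub C CC xC).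
have tri u : u \in C -> [|| u == x, u == y | u == z].
  by move=> /CA; rewrite !inE -orbA.
have [vx|vx] := eqVneq v x; first by rewrite vx in rvs rvt *; apply: extend_alternates_at.
have opp u w : u \in C -> w \in C -> r v u -> r v w -> u = x -> w != x ->
    extend_orientation r o x y z (o z y) v u =
    ~~ extend_orientation r o x y z (o z y) v w.
  move=> uC wC rvu rvw ux wx; subst u.
  rewrite (extend_orientation_out _ _ rsym rx) // extend_orientation_in //.
  have := (tri v vC, tri w wC); rewrite (negPf vx) (negPf wx) /=.
  case=> /orP[]/eqP vE /orP[]/eqP wE; subst; rewrite ?rirr // in rvw *.
    by rewrite eqxx ozy.
  by rewrite eq_sym (negPf yz).
have [sx|sx] := eqVneq s x; first by apply: opp => //; rewrite -sx eq_sym.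
have [tx|tx] := eqVneq t x; first by rewrite (opp t s) ?negbK.
have := (tri v vC, tri s sC, tri t tC); rewrite (negPf vx) (negPf sx) (negPf tx) /=.
case=> -[/orP[]/eqP vE /orP[]/eqP sE] /orP[]/eqP tE; subst;
  by rewrite ?rirr ?eqxx in rvs rvt st.
Qed.

(** * Alternating orientations and cyclic orientations *)

Section Orientations.
Variable G : sgraph.
Implicit Types o : rel G.

Lemma val_ordS n (i : 'I_n) : val (ordS i) = if i.+1 == n then 0%N else i.+1.
Proof.
case: i => i ilt /=; case: eqP => [->|h]; first by rewrite modnn.
by rewrite modn_small //; lia.
Qed.

Lemma ordS_rev n (i j : 'I_n) : (rev_ord i == ordS (rev_ord j)) = (j == ordS i).
Proof.
rewrite -!val_eqE !val_ordS /=; case: i j => i ilt [j jlt] /=.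
by do 2![case: ifPn]; lia.
Qed.

(** Along a directed cycle successors and predecessors are unique, so two different neighbours of
    [x] cannot both follow it or both precede it. *)
Lemma oriented_alternating o :
  orientation o -> (forall C : Cyc G, cyclically_oriented o C) ->
  alternating (@adj G) o.
Proof.
move=> [oor oasym] ocyc C x y z CC xC yC zC axy axz yz.
have /existsP[f /and3P[/injectiveP finj /eqP fC /'forall_'forall_eqP of_]] :=
  ocyc (exist _ C CC).
rewrite /= in f finj fC of_; rewrite -fC in xC yC zC.
have [[i _ xE] [j _ yE]] := (imsetP xC, imsetP yC); have [k _ zE] := imsetP zC.
subst x y z; move: axy axz; rewrite !oor !of_ /dicycle.
have jk : j != k by apply: contraNneq yz => ->.
case: (eqVneq j (ordS i)) => [jE|_]; case: (eqVneq k (ordS i)) => [kE|_] //=.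
  by rewrite jE kE eqxx in jk.
by move=> /eqP ij /eqP ik; rewrite -(inj_eq (can_inj (@ordSK _))) -ij -ik eqxx in jk.
Qed.

(** Alternation at each vertex makes consecutive edges agree along the enumeration [f], so all edges
    follow it or all run against it. *)
Lemma alternating_oriented o (C : Cyc G) :
  orientation o -> alternating (@adj G) o -> cyclically_oriented o C.
Proof.
move=> oor oalt; have CC := valP C; rewrite /cyclically_oriented.
set S := val C in CC *.
move: (CC); rewrite inE => /andP[]; set n := #|S| => n3.
move=> /existsP[f /and3P[/injectiveP finj /eqP fS /'forall_'forall_eqP af]].
have fin i : f i \in S by rewrite -fS imset_f.
have fadj i : adj (f i) (f (ordS i)) by rewrite af /cycle_graph /dicycle eqxx.
have step i : o (f (ordS i)) (f (ordS (ordS i))) = o (f i) (f (ordS i)).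
  have ne : f (ordS (ordS i)) != f i.
    rewrite inj_eq // -val_eqE !val_ordS; case: (i) => k kn /=.
    by do 2![case: ifPn]; lia.
  rewrite (oalt _ _ _ _ CC (fin _) (fin _) (fin i) (fadj _)) //; last by rewrite adj_sym.
  by rewrite (orients_opp oor (fadj i)) negbK.
have n0 : (0 < n)%N by lia.
pose i0 := Ordinal n0; pose b := o (f i0) (f (ordS i0)).
have const i : o (f i) (f (ordS i)) = b.
  case: i; elim=> [|k IH] kn; first by rewrite /b; congr (o (f _) (f (ordS _))); apply: val_inj.
  have kn' : (k < n)%N by lia.
  have -> : Ordinal kn = ordS (Ordinal kn').
    by apply: val_inj; rewrite val_ordS /= ltn_eqF.
  by rewrite step IH.
have oE i j : o (f i) (f j) = if b then j == ordS i else i == ordS j.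
  have [oij|noij] := boolP (o (f i) (f j)).
    have: adj (f i) (f j) by rewrite oor.1 oij.
    rewrite af /cycle_graph /dicycle => /orP[/eqP jE|/eqP iE].
      by move: oij; rewrite jE const => ->; rewrite eqxx.
    have := oor.2 _ _ oij; rewrite iE const => /negPf->.
    by rewrite eqxx.
  apply/esym; case: ifPn => [bT|bF]; apply: contraNF noij => /eqP->; rewrite ?const //.
  by rewrite (orients_opp oor (fadj j)) const.
case bE: b oE => oE.
  apply/existsP; exists f; apply/and3P; split; [exact/injectiveP | exact/eqP |].
  by apply/'forall_'forall_eqP => u v; rewrite oE.
(* All edges run against [f], so the cycle is enumerated backwards. *)
apply/existsP; exists [ffun i => f (rev_ord i)].
have ginj : injective [ffun i => f (rev_ord i)].
  by move=> u v; rewrite !ffunE => /finj/rev_ord_inj.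
apply/and3P; split; first exact/injectiveP.
  rewrite eqEcard card_imset // cardsT card_ord leqnn andbT.
  by apply/subsetP=> _ /imsetP[i _ ->]; rewrite ffunE.
by apply/'forall_'forall_eqP => u v; rewrite !ffunE oE ordS_rev.
Qed.

Lemma cyclically_orientableP :
  cyclically_orientable G <-> exists2 o, orients (@adj G) o & alternating (@adj G) o.
Proof.
split=> [[o [oor ocyc]]|[o oor oalt]]; exists o => //.
  exact: oriented_alternating.
by split=> // C; apply: alternating_oriented.
Qed.

End Orientations.

(** * Edge orders with distinct maximal edges, and triangularity *)

Section Orders.
Variable G : sgraph.

Definition distinct_maxima (le : rel (Edg G)) : Prop :=
  forall (C D : Cyc G) (a b : Edg G), C <> D ->
    maximal_edge le C a -> maximal_edge le D b -> a <> b.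

Lemma alternating_order o : alternating (@adj G) o ->
  exists le : rel (Edg G), linear_order le /\ distinct_maxima le.
Proof.
move=> oalt; have [w winj wP] := alternating_weight (@adj_sym G) (@adj_irr G) oalt.
exists (fun a b => (w (val a) <= w (val b))%N); split.
  split=> [a|a b|a b c|a b]; [exact: leqnn | | exact: leq_trans | exact: leq_total].
  by move=> h; apply/val_inj/winj/eqP; rewrite eqn_leq.
move=> C D a b CD [aC maxC] [bD maxD] ab; subst b.
apply: (wP (val C) (val D) (val a) (valP C) (valP D) _ (valP a) aC bD).
- by apply/negP=> /eqP/val_inj.
- by move=> f fe fC; apply: (maxC (exist _ f fe)).
- by move=> f fe fD; apply: (maxD (exist _ f fe)).
Qed.

Lemma edge_in_cycle (C : Cyc G) : exists a : Edg G, inc_edg_cyc a C.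
Proof.
have CC := valP C; have /set0Pn[x xC] : val C != set0.
  by rewrite -card_gt0; move: CC; rewrite inE => /andP[]; case: #|_|.
have [y [z [_ yC _ nb]]] := chordless_nbrs (@adj_sym G) (@adj_irr G) CC xC.
have e : [set x; y] \in edges G.
  by apply/edge_setsP; exists x, y; rewrite nb // eqxx.
by exists (exist _ [set x; y] e : Edg G); rewrite /inc_edg_cyc /= subUset !sub1set xC yC.
Qed.

(** The equations are solved one cycle at a time, in increasing order of the maximal edges, each by
    adjusting the value on its own maximal edge. *)
Lemma order_surjective le : linear_order le -> distinct_maxima le ->
  forall d, exists c, rho (@inc_edg_cyc G) c = d.
Proof.
move=> [lexx leanti letr letot] maxP d.
(* The number of edges below [a] encodes the order in [nat], where maxima can be chosen. *)
pose w a := #|[set b | le b a]|.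
have w_le a b : (w b <= w a)%N -> le b a.
  move=> wba; have [//|lab] := orP (letot b a).
  apply: contraLR wba => nba; rewrite -ltnNge; apply/proper_card/properP; split.
    by apply/subsetP=> c; rewrite !inE => lca; apply: letr lab.
  by exists b; rewrite inE.
have le_w a b : le b a -> (w b <= w a)%N.
  move=> lba; apply/subset_leq_card/subsetP=> c; rewrite !inE => lcb.
  exact: letr lba.
have [m mP] : exists m : Cyc G -> Edg G, forall C, maximal_edge le C (m C).
  apply: (@fin_all_exists _ (fun=> Edg G)) => C; have [a0 a0C] := edge_in_cycle C.
  case: (@arg_maxnP _ a0 (fun a => inc_edg_cyc a C) w a0C) => a aC amax.
  by exists a; split=> // b bC; apply: w_le; apply: amax.
have m_inj C D : m C = m D -> C = D.
  by have [//|/eqP CD mCD] := eqVneq C D; case: (maxP _ _ _ _ CD (mP C) (mP D)).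
suff [c cP] : exists c : {ffun Edg G -> 'F_2},
    {in [set: Cyc G], forall C, rho (@inc_edg_cyc G) c C = d C}.
  by exists c; apply/ffunP=> C; apply: cP; rewrite inE.
have [n] := ubnP #|[set: Cyc G]|; elim: n [set: Cyc G] => // n IH A /ltnSE-An.
have [->|/set0Pn[C1 C1A]] := eqVneq A set0.
  by exists 0 => C; rewrite inE.
case: (@arg_maxnP _ C1 (mem A) (fun C => w (m C)) C1A) => C0 C0A C0max.
have {}C0A : C0 \in A := C0A.
have [|c cP] := IH (A :\ C0).
  by apply: leq_trans An; rewrite [in X in (_ < X)%N](cardsD1 C0) C0A.
pose v := d C0 - \sum_(a | inc_edg_cyc a C0 && (a != m C0)) c a.
exists [ffun a => if a == m C0 then v else c a] => C CA; rewrite ffunE.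
have [->|CC0] := eqVneq C C0.
  rewrite (bigD1 (m C0)) /=; last by case: (mP C0).
  rewrite ffunE eqxx (eq_bigr c) ?subrK // => a /andP[_ /negPf ne].
  by rewrite ffunE ne.
rewrite -cP ?inE ?CC0 // ffunE; apply: eq_bigr => a aC; rewrite ffunE ifN //.
(* If [m C0] lay on [C], it would be below [m C], which is below [m C0] by the choice of [C0]; the
   two maxima would coincide. *)
apply: contraNneq CC0 => aE; apply/eqP/m_inj/leanti.
by rewrite (w_le _ _ (C0max _ CA)) -aE (mP C).2.
Qed.

End Orders.

(** * Exactness and counting *)

Section RhoCardinal.
Variables (X Y : finType) (I : X -> Y -> bool).

Lemma rhoD (f g : {ffun X -> 'F_2}) : rho I (f + g) = rho I f + rho I g.
Proof.
apply/ffunP=> y; rewrite !ffunE -big_split.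
by apply: eq_bigr => x _; rewrite ffunE.
Qed.

Lemma rhoB (f g : {ffun X -> 'F_2}) : rho I (f - g) = rho I f - rho I g.
Proof. by apply/eqP; rewrite eq_sym subr_eq -rhoD subrK. Qed.

Lemma card_ffunF2 (Z : finType) : #|{: {ffun Z -> 'F_2}}| = (2 ^ #|Z|)%N.
Proof. by rewrite card_ffun card_Fp. Qed.

(** A counting form of rank-nullity: every fibre over the image is a translate of the kernel. *)
Lemma card_rho :
  (#|[set f | rho I f == 0%R]| * #|[set rho I f | f in [set: {ffun X -> 'F_2}]]| =
   2 ^ #|X|)%N.
Proof.
rewrite -card_ffunF2 -cardsT -[RHS]sum1_card.
rewrite [RHS](partition_big_imset (rho I)) /= mulnC -sum_nat_const.
apply: eq_bigr => _ /imsetP[f _ ->].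
rewrite sum1dep_card -(card_imset _ (addrI f)); apply: eq_card => g.
rewrite !inE; apply/imsetP/eqP => [[h]|gf].
  by rewrite inE => /eqP h0 ->; rewrite rhoD h0 addr0.
by exists (g - f); [rewrite inE rhoB gf subrr | rewrite addrC subrK].
Qed.

End RhoCardinal.

Section Exactness.
Variable G : sgraph.

Let asym := @adj_sym G.
Let airr := @adj_irr G.

Lemma component_connect (K : Con G) x y :
  x \in val K -> (y \in val K) = connect (@adj G) x y.
Proof.
have csym := sym_connect_sym asym.
have /imsetP[z _ ->] := valP K; rewrite !inE => zx.
by apply/idP/idP => h; [rewrite csym in zx|]; apply: connect_trans h.
Qed.

Lemma component_of x : exists K : Con G, x \in val K.
Proof.
have xK : [set y in [set: G] | connect (@adj G) x y] \in components G.
  by apply: imset_f.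
by exists (exist (fun A => A \in components G) _ xK); rewrite !inE connect0.
Qed.

Lemma component_nonempty (K : Con G) : exists x, x \in val K.
Proof.
by have /imsetP[z _ ->] := valP K; exists z; rewrite !inE connect0.
Qed.

Lemma rho_con_ver f (K : Con G) x : x \in val K -> rho (@inc_con_ver G) f x = f K.
Proof.
move=> xK; rewrite ffunE (big_pred1 K) // => K' /=; apply/idP/eqP => [xK'|->//].
by apply/val_inj/setP=> y; rewrite (component_connect y xK) (component_connect y xK').
Qed.

Lemma rho_ver_edg phi (a : Edg G) u v : adj u v -> val a = [set u; v] ->
  rho (@inc_ver_edg G) phi a = phi u + phi v.
Proof.
move=> auv aE; have uv : u != v by apply: contraTneq auv => ->; rewrite airr.
by rewrite ffunE -(sum_pair phi uv) -aE.
Qed.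

Lemma rho_edg_cyc (c : {set G} -> 'F_2) (C : Cyc G) :
  rho (@inc_edg_cyc G) [ffun a => c (val a)] C = cycle_sum (@adj G) c (val C).
Proof.
rewrite ffunE /cycle_sum [RHS]big_sub_cond.
by apply: eq_bigr => a _; rewrite ffunE.
Qed.

(** Extension by zero off the edges, so that [cycle_sum] applies. *)
Lemma edge_functionP (f : {ffun Edg G -> 'F_2}) :
  exists c : {set G} -> 'F_2, f = [ffun a => c (val a)].
Proof.
exists (fun e => if insub e is Some a then f a else 0).
by apply/ffunP=> a; rewrite ffunE valK.
Qed.

Lemma rho_con_ver_inj f : rho (@inc_con_ver G) f = 0 -> f = 0.
Proof.
move=> f0; apply/ffunP=> K; have [x xK] := component_nonempty K.
by rewrite -(rho_con_ver f xK) f0 !ffunE.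
Qed.

Lemma exact_at_ver : exact_at (rho (@inc_con_ver G)) (rho (@inc_ver_edg G)).
Proof.
move=> phi; split=> [phi0|[f <-]].
  have phi_adj u v : adj u v -> phi u = phi v.
    move=> auv; have e : [set u; v] \in edges G by apply/edge_setsP; exists u, v.
    have /ffunP/(_ (exist _ [set u; v] e : Edg G)) := phi0.
    rewrite (rho_ver_edg phi auv) // ffunE => /eqP; rewrite addr_eq0 => /eqP->.
    by apply/eqP; rewrite eq_sym -addr_eq0 addF2.
  have phi_con u v : connect (@adj G) u v -> phi u = phi v.
    move=> /connectP[p + ->]; elim: p u => //= w p IH u /andP[auw /IH <-].
    exact: phi_adj.
  (* As [phi] is constant on components, its values at chosen representatives give a preimage. *)
  have [pt ptP] := fin_all_exists component_nonempty.
  exists [ffun K => phi (pt K)]; apply/ffunP=> x.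
  have [K xK] := component_of x; rewrite (rho_con_ver _ xK) ffunE.
  by apply: phi_con; rewrite -(component_connect _ (ptP K)).
apply/ffunP=> a; have /edge_setsP[u [v [auv aE]]] := valP a.
rewrite (rho_ver_edg _ auv aE) [RHS]ffunE; have [K uK] := component_of u.
have vK : v \in val K by rewrite (component_connect _ uK) connect1.
by rewrite (rho_con_ver _ uK) (rho_con_ver _ vK) addF2.
Qed.

Lemma exact_at_edg : exact_at (rho (@inc_ver_edg G)) (rho (@inc_edg_cyc G)).
Proof.
move=> f; split=> [f0|[phi <-]].
  have [c cE] := edge_functionP f; subst f.
  have [C CC|phi phiP] := cycle_sum0_potential (c := c) asym airr.
    by rewrite -(rho_edg_cyc c (exist _ C CC : Cyc G)) f0 ffunE.
  exists [ffun x => phi x]; apply/ffunP=> a.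
  have /edge_setsP[u [v [auv aE]]] := valP a.
  by rewrite (rho_ver_edg _ auv aE) !ffunE aE phiP.
apply/ffunP=> C.
pose c (e : {set G}) := \sum_(u in e) phi u.
have -> : rho (@inc_ver_edg G) phi = [ffun a => c (val a)].
  by apply/ffunP=> a; rewrite !ffunE.
by rewrite (rho_edg_cyc c) coboundary_cycle_sum ?ffunE //; apply: valP.
Qed.

Definition rho_surjective : Prop :=
  forall d, exists c, rho (@inc_edg_cyc G) c = d.

Lemma rho_surjective_exact : rho_surjective <->
  exact_sequence (rho (@inc_con_ver G)) (rho (@inc_ver_edg G))
    (rho (@inc_edg_cyc G)).
Proof.
split=> [sur|[]//]; split=> //.
- exact: rho_con_ver_inj.
- exact: exact_at_ver.
- exact: exact_at_edg.
Qed.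

Lemma rho_surjective_independent : rho_surjective -> independent (@adj G).
Proof.
move=> sur D; have [f fE] := sur [ffun C => D (val C)].
have [c cE] := edge_functionP f; exists c => C CC.
have := rho_edg_cyc c (exist _ C CC : Cyc G).
by rewrite -cE fE ffunE.
Qed.

(** Exactness at the earlier terms fixes the size of the image of the last map; surjectivity says
    that this size is that of the whole target. *)
Lemma rho_surjective_card :
  rho_surjective <-> (#|Cyc G| + #|Ver G| = #|Edg G| + #|Con G|)%N.
Proof.
pose im (X Y : finType) (I : X -> Y -> bool) := [set rho I f | f in [set: {ffun X -> 'F_2}]].
have ker_im (X Y Z : finType) (I : X -> Y -> bool) (J : Y -> Z -> bool) :
    exact_at (rho I) (rho J) -> [set f | rho J f == 0] = im _ _ I.
  move=> ex; apply/setP=> f; rewrite inE; apply/eqP/imsetP => [/ex[g <-]|[g _ ->]].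
    by exists g.
  by apply/ex; exists g.
have := card_rho (@inc_ver_edg G); rewrite (ker_im _ _ _ _ _ exact_at_ver).
rewrite {1}/im card_imset ?cardsT ?card_ffunF2; last first.
  move=> f g fg; apply/eqP; rewrite -subr_eq0; apply/eqP/rho_con_ver_inj.
  by rewrite rhoB fg subrr.
have := card_rho (@inc_edg_cyc G); rewrite (ker_im _ _ _ _ _ exact_at_edg).
rewrite -/(im _ _ _); set a := #|im _ _ _| => cE cV.
pose h := #|im _ _ (@inc_edg_cyc G)|.
(* The size [a] of the coboundary space is eliminated between [cE] and [cV]. *)
have cH : (2 ^ #|Ver G| * h = 2 ^ (#|Edg G| + #|Con G|))%N.
  by rewrite expnD -cE -cV -/h; lia.
have surE : rho_surjective <-> h = (2 ^ #|Cyc G|)%N.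
  rewrite -card_ffunF2 -cardsT; split=> [sur|hE d].
    congr (#|pred_of_set _|); apply/setP=> d; rewrite inE; apply/imsetP.
    by have [c <-] := sur d; exists c.
  have /eqP imT : im _ _ (@inc_edg_cyc G) == [set: {ffun Cyc G -> 'F_2}].
    by rewrite eqEcard subsetT /= -hE.
  have : d \in im _ _ (@inc_edg_cyc G) by rewrite imT inE.
  by case/imsetP=> c _ ->; exists c.
rewrite surE; split=> [hE|nE].
  by apply: (@expnI 2) => //; rewrite -cH hE -expnD addnC.
apply/eqP; rewrite -(@eqn_pmul2l (2 ^ #|Ver G|)) ?expn_gt0 //.
by rewrite cH -expnD [(#|Ver G| + _)%N]addnC nE.
Qed.

End Exactness.

(** Orientability gives an order, an order gives surjectivity, and surjectivity gives orientability;
    the count and the exact sequence are each equivalent to surjectivity. *)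
Theorem theorem5p1 (G : sgraph) :
  [/\ cyclically_orientable G <->
        (exists le : rel (Edg G), linear_order le /\
          forall (C D : Cyc G) (a b : Edg G), C <> D ->
            maximal_edge le C a -> maximal_edge le D b -> a <> b),
      cyclically_orientable G <->
        (#|Cyc G|%:Z = #|Edg G|%:Z - #|Ver G|%:Z + #|Con G|%:Z)
    & cyclically_orientable G <->
        exact_sequence (rho (@inc_con_ver G)) (rho (@inc_ver_edg G))
          (rho (@inc_edg_cyc G))].
Proof.
have co_order : cyclically_orientable G -> exists le : rel (Edg G),
    linear_order le /\ distinct_maxima le.
  by move=> /cyclically_orientableP[o _ /alternating_order].
have order_sur : (exists le : rel (Edg G), linear_order le /\ distinct_maxima le) ->
    rho_surjective G.
  by case=> le [lin dist]; apply: order_surjective lin dist.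
have sur_co : rho_surjective G -> cyclically_orientable G.
  move=> /rho_surjective_independent ind; apply/cyclically_orientableP.
  exact: independent_alternating (@adj_sym G) (@adj_irr G) ind.
have co_sur : cyclically_orientable G <-> rho_surjective G.
  by split=> // /co_order/order_sur.
split.
- by split=> [/co_order|/order_sur/sur_co].
- rewrite co_sur rho_surjective_card; split; lia.
- by rewrite co_sur rho_surjective_exact.
Qed.
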